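(* Let $I=[0,1]$ or $I=[0,\infty)$ and let $X$ be a Banach r.i. space on $I$. Then $$\mathcal{LI}(\Lambda(X),M^*(X);L^\infty)=\mathcal{QLI}(\Lambda(X),M^*(X);L^\infty)=\mathcal{M}(\Lambda(X),M^*(X)),$$ and, if $I=[0,1]$, these classes are also equal to $\mathcal{LPI}(\Lambda(X),M^*(X);L^\infty)$. Furthermore, a couple of spaces $(Y,Z)$ belongs to any of these classes if and only if the operator $Q_{\Lambda(X)}$ defined by $$Q_{\Lambda(X)}\varphi(t)=\frac{1}{\phi_X(t)}\int_0^t\varphi(x)\,d\phi_X(x)$$ is bounded from $Y$ into $Z$ for nonincreasing functions, i.e. there is a constant $K$ with $\|Q_{\Lambda(X)}\varphi\|_Z\le K\|\varphi\|_Y$ for all nonnegative nonincreasing $\varphi\in Y$.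
   Context: All functions are real-valued Lebesgue measurable on $I$; $f^*$ is the nonincreasing rearrangement of $f$. A Banach r.i. (rearrangement invariant) space on $I$ is a Banach space $(X,\|\cdot\|)$ of locally integrable functions on $I$ such that: (i) $|g|\le|f|$ a.e., $f\in X$ imply $g\in X$, $\|g\|\le\|f\|$; (ii) (Fatou) $0\le f_n\uparrow$, $\sup_n\|f_n\|<\infty$ imply $f=\sup f_n\in X$ and $\|f\|=\sup_n\|f_n\|$; (iii) $X$ contains the simple integrable functions; (iv) $f\in X\iff f^*\in X$, and $\|f\|=\|f^*\|$. A quasi-Banach r.i. space is a complete quasi-normed space of measurable functions satisfying (i)-(iv) (the triangle inequality holds with a constant; local integrability is not required). The fundamental function of $X$ is $\phi_X(t)=\|\chi_{[0,t]}\|_X$; for Banach r.i. $X$ it is assumed (without loss of generality, up to equivalent renorming) positive for $t>0$, nondecreasing, concave and absolutely continuous away from the origin, with $\phi_X(0)=0$. $\Lambda(X)$ is the space of measurable $f$ with $\|f\|_{\Lambda(X)}=\int_I f^*(t)\,d\phi_X(t)<\infty$ (Stieltjes integral, a jump of $\phi_X$ at $0$ being counted). $M^*(X)$ is the space of measurable $f$ with $\|f\|_{M^*(X)}=\sup_{t\in I}\phi_X(t)f^*(t)<\infty$ (a quasi-norm). Let $(A_0,A_1)$ be a couple of quasi-Banach r.i. spaces. The classes below consist of couples $(X_0,X_1)$ of quasi-Banach r.i. spaces on $I$ with $A_i\cap L^\infty\hookrightarrow X_i\hookrightarrow A_i+L^\infty$ (continuous embeddings), $i=0,1$; ''couple of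 spaces'' in the claim means such a couple. $\mathcal{LI}(A_0,A_1;L^\infty)$ [resp. $\mathcal{QLI}(A_0,A_1;L^\infty)$]: every linear [resp. quasilinear] operator $T:A_0+L^\infty\to A_1+L^\infty$ that is bounded from $A_0$ into $A_1$ and from $L^\infty$ into $L^\infty$ is also bounded from $X_0$ into $X_1$. Here $T$ is quasilinear if $|T(\lambda f)|=|\lambda||Tf|$ and $|T(f+g)|\le K(|Tf|+|Tg|)$ for some constant $K\ge 1$; bounded means $\|Tf\|\le C\|f\|$ for some $C$. $\mathcal{LPI}(A_0,A_1;L^\infty)$: every operator $T:A_0+L^\infty\to A_1+L^\infty$ that is a Lipschitz operator from $A_0$ into $A_1$ and from $L^\infty$ into $L^\infty$ also maps $X_0$ into $X_1$. Here $T:E\to F$ is a Lipschitz operator if $T(0)=0$ and $\|Tf-Tg\|_F\le C\|f-g\|_E$ for some constant $C$. $\mathcal{M}(A_0,A_1)$: there is a constant $C\ge1$ such that whenever $f\in X_0$, $g\in A_1+L^\infty$ and $\|f^*\chi_{[0,t]}\|_{A_0}\ge\|g^*\chi_{[0,t]}\|_{A_1}$ for all $t>0$, then $g\in X_1$ and $\|g\|_{X_1}\le C\|f\|_{X_0}$. *)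

(* Defs.v *)
From HB Require Import structures.
From mathcomp Require Import all_boot all_order all_algebra.
From mathcomp Require Import all_classical all_reals all_analysis.
From mathcomp Require Import measurable_realfun ess_sup_inf.

Set Implicit Arguments.
Unset Strict Implicit.
Unset Printing Implicit Defensive.

Import Order.TTheory GRing.Theory Num.Theory.
Import numFieldNormedType.Exports.

Local Open Scope classical_set_scope.
Local Open Scope ring_scope.

(* R equipped with the sigma-algebra of Lebesgue (not only Borel) measurable
   sets, on which completed_lebesgue_measure lives. *)
Definition LebR (R : realType) := caratheodory_type (@wlength R idfun)^*%mu.
Notation leb := completed_lebesgue_measure.

Section FunctionSpaces.
Context {R : realType}.
Implicit Types (I : set R) (f g : R -> R).

Definition lmeas I f : Prop := @measurable_fun _ _ (LebR R) R I f.
Definition aeI I (P : R -> Prop) : Prop := {ae (@leb R), forall x, I x -> P x}.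

Definition distr I f (s : R) : \bar R :=
  leb (I `&` [set x | s < `|f x|] : set (LebR R)).

(* The rearrangement may take the value +oo: at 0 when f is unbounded, and
   everywhere on [0, +oo[ for functions such as f x = x. *)
Definition rearr I f (t : R) : \bar R :=
  ereal_inf [set s%:E | s in [set s : R | 0 <= s /\ (distr I f s <= t%:E)%E]].
Definition rearrR I f (t : R) : R := fine (rearr I f t).

(* A space of functions on I, the carrier being closed under equality a.e. on I;
   the norm is only meaningful on the carrier. *)
Record fspace := FSpace {
  carrier :> (R -> R) -> Prop;
  fnorm : (R -> R) -> R }.
Implicit Types (X Y Z E F A B : fspace).

(* The norm, set to +oo outside of the space. *)
Definition enorm X f : \bar R := if `[< X f >] then (fnorm X f)%:E else +oo%E.

Record quasi_normed I (K : R) X : Prop := {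
  qn_meas : forall f, X f -> lmeas I f;
  qn_add : forall f g, X f -> X g -> X (f \+ g);
  qn_scale : forall (c : R) f, X f -> X (c \*o f);
  qn_ge0 : forall f, X f -> 0 <= fnorm X f;
  qn_eq0 : forall f, X f -> (fnorm X f = 0 <-> aeI I (fun x => f x = 0));
  qn_norm_scale : forall (c : R) f, X f -> fnorm X (c \*o f) = `|c| * fnorm X f;
  qn_triangle : forall f g, X f -> X g ->
    fnorm X (f \+ g) <= K * (fnorm X f + fnorm X g) }.

Definition norm_complete X : Prop :=
  forall u : nat -> (R -> R), (forall n, X (u n)) ->
    (forall e : R, 0 < e -> exists N : nat, forall m n : nat,
       (N <= m)%N -> (N <= n)%N -> fnorm X (u m \- u n) < e) ->
    exists2 f, X f & fnorm X (u n \- f) @[n --> \oo] --> 0.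

Record ri_axioms I X : Prop := {
  ri_ideal : forall f g, X f -> lmeas I g ->
    aeI I (fun x => `|g x| <= `|f x|) -> X g /\ fnorm X g <= fnorm X f;
  ri_fatou : forall u : nat -> (R -> R), (forall n, X (u n)) ->
    aeI I (fun x => forall n, 0 <= u n x <= u n.+1 x) ->
    has_ubound (range (fun n => fnorm X (u n))) ->
    exists f, [/\ X f,
      aeI I (fun x => (f x)%:E = ereal_sup (range (fun n => (u n x)%:E))) &
      fnorm X f = sup (range (fun n => fnorm X (u n)))];
  ri_simple : forall f, lmeas I f -> finite_set (f @` I) ->
    (leb (I `&` [set x | f x != 0%R] : set (LebR R)) < +oo)%E -> X f;
  ri_memE : forall f, lmeas I f ->
    (X f <-> (forall t, I t -> 0 < t -> (rearr I f t < +oo)%E) /\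
             X (rearrR I f));
  ri_normE : forall f, X f -> fnorm X f = fnorm X (rearrR I f) }.

Definition quasi_banach_ri I X : Prop :=
  [/\ exists2 K : R, 1 <= K & quasi_normed I K X, norm_complete X
    & ri_axioms I X].

Definition locally_integrable_on I f : Prop :=
  lmeas I f /\ forall C : set R, C `<=` I -> compact C ->
    (\int[@leb R]_(x in (C : set (LebR R))) `|f x|%:E < +oo)%E.

Record banach_ri I := BanachRI {
  bri_space :> fspace;
  bri_normed : quasi_normed I 1 bri_space;
  bri_complete : norm_complete bri_space;
  bri_ri : ri_axioms I bri_space;
  bri_locint : forall f, bri_space f -> locally_integrable_on I f }.

Definition fundamental X (t : R) : R := fnorm X (\1_(`[0, t]%classic)).

Definition abs_continuous (a b : R) (h : R -> R) : Prop :=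
  forall e : R, 0 < e -> exists2 d : R, 0 < d &
    forall (n : nat) (x y : nat -> R),
      (forall i, (i < n)%N -> [/\ a <= x i, x i <= y i & y i <= b]) ->
      trivIset `I_n (fun i => `]x i, y i[%classic) ->
      \sum_(i < n) (y i - x i) < d ->
      \sum_(i < n) `|h (y i) - h (x i)| < e.

Record standard_fundamental I X : Prop := {
  fund0 : fundamental X 0 = 0;
  fund_gt0 : forall t, I t -> 0 < t -> 0 < fundamental X t;
  fund_nd : {in I &, {homo fundamental X : s t / s <= t}};
  fund_concave : convex_function (I : set R) (\- fundamental X);
  fund_ac : forall a b, I a -> I b -> 0 < a -> a <= b ->
    abs_continuous a b (fundamental X) }.

(* Right-continuous version of the fundamental function. Since \1_[0, t] is 0
   for t < 0 and is 1 on I for t >= sup I, it is constant outside of I. *)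
Definition fundamental_rc X (t : R) : R :=
  inf [set fundamental X s | s in `]t, +oo[].

End FunctionSpaces.

Section Stieltjes.
Context {R : realType} (I : set R) (X : banach_ri I).

Lemma lmeas_indic_itv t : lmeas I (\1_(`[0, t]%classic)).
Proof.
apply: (@measurable_indic _ (LebR R)).
by apply: sub_caratheodory; exact: measurable_itv.
Qed.

Lemma fundamental_mem t : X (\1_(`[0, t]%classic)).
Proof.
apply: (ri_simple (bri_ri X)); first exact: lmeas_indic_itv.
  apply: (@sub_finite_set _ _ [set 0; 1]) => //.
  by move=> y [x _ <-]; rewrite indicE /=; case: (_ \in _); [right|left].
apply: (@le_lt_trans _ _ (leb (`[0, t]%classic : set (LebR R)))).
  apply: le_outer_measure => x [_] /=; rewrite indicE.
  by case: (boolP (x \in _)) => [/set_mem//|]; rewrite eqxx.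
have -> : leb (`[0, t]%classic : set (LebR R)) =
          lebesgue_measure (`[0, t]%classic : set R) by [].
by rewrite lebesgue_measure_itv/=; case: ifP => _; rewrite ?sube0 ltry.
Qed.

Lemma fundamental_nondecreasing :
  {homo fundamental X : s t / s <= t}.
Proof.
move=> s t st.
have [|_] := ri_ideal (bri_ri X) (fundamental_mem t) (lmeas_indic_itv s).
  apply: aeW => x _ /=; rewrite !indicE.
  have [/set_mem|_] := boolP (x \in `[0, s]%classic); last by rewrite normr0.
  rewrite /= in_itv/= => /andP[x0 xs].
  by rewrite mem_set//= in_itv/= x0 (le_trans xs).
by [].
Qed.

Let lb t : has_inf [set fundamental X s | s in `]t, +oo[].
Proof.
split; first by exists (fundamental X (t + 1)), (t + 1) => //=;
  rewrite in_itv/= andbT ltrDl.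
exists (fundamental X t) => y [s /= + <-]; rewrite in_itv/= andbT => ts.
by apply: fundamental_nondecreasing; exact: ltW.
Qed.

Lemma fundamental_rc_nondecreasing : {homo fundamental_rc X : s t / s <= t}.
Proof.
move=> s t st; apply: lb_le_inf; first by case: (lb t).
move=> y [r /= + <-]; rewrite in_itv/= andbT => tr.
apply: ge_inf; first by case: (lb s).
by exists r => //=; rewrite in_itv/= andbT (le_lt_trans st).
Qed.

Lemma fundamental_rc_right_continuous : right_continuous (fundamental_rc X).
Proof.
move=> t; apply/cvgrPdist_lt => e e0.
have [_ [s /= ts <-]] := inf_adherent e0 (lb t).
rewrite in_itv/= andbT in ts => se.
near=> r.
have tr : t < r by near: r; exact: nbhs_right_gt.
rewrite distrC ger0_norm ?subr_ge0 ?fundamental_rc_nondecreasing ?(ltW tr)//.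
rewrite ltrBlDl; apply: le_lt_trans se; apply: ge_inf; first by case: (lb r).
by exists s => //=; rewrite in_itv/= andbT; near: r; exact: nbhs_right_lt.
Unshelve. all: by end_near. Qed.

HB.instance Definition _ := isCumulative.Build R _ R (fundamental_rc X)
  fundamental_rc_nondecreasing fundamental_rc_right_continuous.

(* d phi_X; the mass at 0 is the jump fundamental X (0+). *)
Definition dphi : set (measurableTypeR R) -> \bar R :=
  lebesgue_stieltjes_measure (fundamental_rc X).

End Stieltjes.

Section Spaces.
Context {R : realType} (I : set R).
Implicit Types (X : banach_ri I) (Y Z E F A B : @fspace R).
Implicit Types (f g : R -> R) (T : (R -> R) -> (R -> R)).

(* The jump of the fundamental function at 0 contributes its size times
   rearr I f 0, the essential supremum of |f|. *)
Definition Lambda_norm X f : \bar R := (\int[dphi X]_(t in I) rearr I f t)%E.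

Definition Lambda X : fspace :=
  FSpace (fun f => lmeas I f /\ (Lambda_norm X f < +oo)%E)
         (fun f => fine (Lambda_norm X f)).

(* At t = 0 the product is 0, even when rearr I f 0 = +oo; a jump of the
   fundamental function at 0 is accounted for by the small t > 0. *)
Definition Mstar_norm X f : \bar R :=
  ereal_sup [set ((fundamental X t)%:E * rearr I f t)%E | t in I].

Definition Mstar X : fspace :=
  FSpace (fun f => lmeas I f /\ (Mstar_norm X f < +oo)%E)
         (fun f => fine (Mstar_norm X f)).

Definition Linfty_norm f : \bar R :=
  ess_sup (@leb R) ((fun x => `|f x|%:E) \_ I).

Definition Linfty : fspace :=
  FSpace (fun f => lmeas I f /\ (Linfty_norm f < +oo)%E)
         (fun f => fine (Linfty_norm f)).

Definition cap_space A B : fspace :=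
  FSpace (fun f => A f /\ B f) (fun f => Num.max (fnorm A f) (fnorm B f)).

Definition sum_decomp A B f (ab : (R -> R) * (R -> R)) : Prop :=
  [/\ A ab.1, B ab.2 & aeI I (fun x => f x = ab.1 x + ab.2 x)].

Definition sum_space A B : fspace :=
  FSpace (fun f => lmeas I f /\ exists ab, sum_decomp A B f ab)
    (fun f => inf [set fnorm A ab.1 + fnorm B ab.2 | ab in sum_decomp A B f]).

Definition embeds E F : Prop :=
  (forall f, E f -> F f) /\
  exists C : R, forall f, E f -> fnorm F f <= C * fnorm E f.

Definition couple A0 A1 Y Z : Prop :=
  [/\ quasi_banach_ri I Y, quasi_banach_ri I Z,
      embeds (cap_space A0 Linfty) Y /\ embeds Y (sum_space A0 Linfty)
    & embeds (cap_space A1 Linfty) Z /\ embeds Z (sum_space A1 Linfty)].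

(* An operator between spaces of functions identified when equal a.e. on I. *)
Definition operator E F T : Prop :=
  (forall f, E f -> F (T f)) /\
  (forall f g, E f -> E g -> aeI I (fun x => f x = g x) ->
     aeI I (fun x => T f x = T g x)).

Definition linear_op E T : Prop :=
  (forall (c : R) f, E f -> aeI I (fun x => T (c \*o f) x = c * T f x)) /\
  (forall f g, E f -> E g -> aeI I (fun x => T (f \+ g) x = T f x + T g x)).

Definition quasilinear_op E T : Prop :=
  (forall (c : R) f, E f ->
     aeI I (fun x => `|T (c \*o f) x| = `|c| * `|T f x|)) /\
  exists2 K : R, 1 <= K & forall f g, E f -> E g ->
     aeI I (fun x => `|T (f \+ g) x| <= K * (`|T f x| + `|T g x|)).

Definition bounded_op E F T : Prop :=
  exists C : R, forall f, E f -> F (T f) /\ fnorm F (T f) <= C * fnorm E f.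

Definition lipschitz_op E F T : Prop :=
  [/\ aeI I (fun x => T (cst 0) x = 0),
      forall f, E f -> F (T f)
    & exists C : R, forall f g, E f -> E g ->
        fnorm F (T f \- T g) <= C * fnorm E (f \- g)].

Definition class_LI A0 A1 : set (fspace * fspace) :=
  [set YZ | couple A0 A1 YZ.1 YZ.2 /\
     forall T, operator (sum_space A0 Linfty) (sum_space A1 Linfty) T ->
       linear_op (sum_space A0 Linfty) T ->
       bounded_op A0 A1 T -> bounded_op Linfty Linfty T ->
       bounded_op YZ.1 YZ.2 T].

Definition class_QLI A0 A1 : set (fspace * fspace) :=
  [set YZ | couple A0 A1 YZ.1 YZ.2 /\
     forall T, operator (sum_space A0 Linfty) (sum_space A1 Linfty) T ->
       quasilinear_op (sum_space A0 Linfty) T ->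
       bounded_op A0 A1 T -> bounded_op Linfty Linfty T ->
       bounded_op YZ.1 YZ.2 T].

Definition class_LPI A0 A1 : set (fspace * fspace) :=
  [set YZ | couple A0 A1 YZ.1 YZ.2 /\
     forall T, operator (sum_space A0 Linfty) (sum_space A1 Linfty) T ->
       lipschitz_op A0 A1 T -> lipschitz_op Linfty Linfty T ->
       forall f, YZ.1 f -> YZ.2 (T f)].

Definition rearr_cut f (t : R) : R -> R :=
  fun x => rearrR I f x * \1_(`[0, t]%classic) x.

Definition class_M A0 A1 : set (fspace * fspace) :=
  [set YZ | couple A0 A1 YZ.1 YZ.2 /\
     exists2 C : R, 1 <= C &
       forall f g, YZ.1 f -> sum_space A1 Linfty g ->
         (forall t, 0 < t ->
            (enorm A1 (rearr_cut g t) <= enorm A0 (rearr_cut f t))%E) ->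
         YZ.2 g /\ fnorm YZ.2 g <= C * fnorm YZ.1 f].

(* A nonincreasing element of Y may be unbounded at the origin, so that its
   (immaterial) real value at 0 is disregarded. *)
Definition nonneg_nonincreasing f : Prop :=
  (forall x, I x -> 0 < x -> 0 <= f x) /\
  (forall x y, I x -> I y -> 0 < x -> x <= y -> f y <= f x).

(* f with its value at 0, which matters when dphi has a mass there, replaced by
   f (0+). *)
Definition at0_right f (x : R) : \bar R :=
  if x == 0 then lim ((f y)%:E @[y --> 0^'+]) else (f x)%:E.

Definition QLambda X f (t : R) : \bar R :=
  ((fundamental X t)^-1%:E * \int[dphi X]_(x in `[0%R, t]) at0_right f x)%E.

Definition QLambda_bounded X Y Z : Prop :=
  exists K : R, forall f, Y f -> nonneg_nonincreasing f ->
    [/\ forall t, I t -> 0 < t -> QLambda X f t \is a fin_num,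
        Z (fine \o QLambda X f)
      & fnorm Z (fine \o QLambda X f) <= K * fnorm Y f].

End Spaces.

(* Main.v *)
From HB Require Import structures.
Require Import Defs.
From mathcomp Require Import all_boot all_order all_algebra.
From mathcomp Require Import all_classical all_reals all_analysis.
From mathcomp Require Import measurable_realfun ess_sup_inf.
From mathcomp Require Import ring lra.

(** Write [phi] for the fundamental function. Everything revolves around the
inequality [phi(t) g^*(t) <= C \int_[0,t] f^* dphi] for all [t], which says that
[g^* <= C Q f^*]. It holds for [g = T f] as soon as [T] is bounded from
[Lambda(X)] into [M^*(X)] and on [L^oo]: split [f] by truncation at the height
[f^*(t)]. Hence the boundedness of [Q] gives the class [M], and [M] gives the
interpolation properties.

Conversely, let [w(x) = 2 (phi(x) - phi(x/2)) / x], a nonincreasing substitute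
for [phi']. The linear operator [f |-> phi(t)^-1 \int_0^t f w] is bounded from
[Lambda(X)] into [M^*(X)] and on [L^oo], by a Hardy-Littlewood inequality, and it
dominates on nonincreasing functions the part of [Q] that comes from [dphi] on
[]0, +oo[]. A jump of [phi] at [0] needs no operator: in that case [1/phi] lies in
[M^*] and [L^oo], hence in [Z], while [f(0+)] is controlled by the norm of [f] in
[Y]. That the operator maps [Y] into [Z] already implies a norm estimate on
nonnegative functions, by a gliding hump argument and the Fatou property. *)

Set Implicit Arguments.
Unset Strict Implicit.
Unset Printing Implicit Defensive.

Import Order.TTheory GRing.Theory Num.Theory.
Import numFieldNormedType.Exports.

Local Open Scope classical_set_scope.
Local Open Scope ring_scope.

(** * Rearrangements *)

(** Three obstacles shape the details. Admissible operators act on functions up to null sets,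
    whereas [dphi] may have an atom at 0 and f(0+) has no meaning for a general f; so Q itself
    cannot be tested, and Lebesgue measure with the density [weight] takes the place of [dphi]. That
    density is the mean slope of phi over [x/2, x], so that on dyadic blocks its integral is
    comparable to increments of phi, the sums telescope, and no derivative of phi appears. Next,
    rearrangements are right continuous: their superlevel sets are half-open intervals and a cut has
    rearrangement 0 at its end point. The doubling inequality phi(2t) <= 2 phi(t) repairs each such
    loss at the price of a factor 2, which is where most constants come from. Finally, norms are
    real numbers that mean something only on the carrier, so membership has to be proved before a
    norm estimate can be used; this concerns above all the differences that occur in Lipschitz
    conditions. *)

#[local] Instance leb_ae_filter (R : realType) :
  Filter (nbhs (almost_everywhere (@leb R))).
Proof. exact: ae_filter_ringOfSetsType. Qed.

Section Interval.
Context {R : realType} (I : set R).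
Hypothesis hI : I = `[0%R, 1%R]%classic \/ I = `[0%R, +oo[%classic.

Lemma I_ge0 x : I x -> 0 <= x.
Proof. by case: hI => ->; rewrite /= in_itv/= ?andbT => // /andP[]. Qed.

Lemma I_down t x : I t -> 0 <= x -> x <= t -> I x.
Proof.
case: hI => ->; rewrite /= !in_itv/= ?andbT// => /andP[_ t1] x0 xt.
by rewrite x0 (le_trans xt t1).
Qed.

Lemma I_0 : I 0.
Proof. by case: hI => ->; rewrite /= in_itv/= lexx ?ler01. Qed.

Lemma subset_itv_I (b : bool) t : I t ->
  [set` Interval (BSide b 0) (BRight t)] `<=` I.
Proof.
move=> It x; rewrite /= in_itv/= => /andP[x0 xt]; apply: I_down It _ xt.
by move: x0; case: b => //= /ltW.
Qed.

Lemma measurable_I : measurable I.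
Proof. by case: hI => ->; exact: measurable_itv. Qed.

Lemma lebesgue_of_borel (A : set R) : measurable A -> measurable (A : set (LebR R)).
Proof. by move=> mA; exact: sub_caratheodory. Qed.

Lemma lmeas_of_borel (D : set R) (f : R -> R) : measurable D ->
  measurable_fun D f -> lmeas D f.
Proof.
by move=> mD mf _ B mB; apply: lebesgue_of_borel; exact: mf.
Qed.

Lemma leb_itv (i : interval R) : leb ([set` i] : set (LebR R)) =
  (if i.1 < i.2 then (i.2 : \bar R) - i.1 else 0)%E.
Proof. by rewrite -lebesgue_measure_itv. Qed.

Lemma leb_subset (A B : set R) : A `<=` B ->
  (leb (A : set (LebR R)) <= leb (B : set (LebR R)))%E.
Proof. by move=> AB; exact: le_outer_measure. Qed.

Lemma leb_ae_subset (A B : set R) : {ae (@leb R), forall x, A x -> B x} ->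
  (leb (A : set (LebR R)) <= leb (B : set (LebR R)))%E.
Proof.
move=> [N [mN N0 AN]].
apply: (@le_trans _ _ (leb (B `|` N : set (LebR R)))).
  apply: leb_subset => x Ax; have [Bx|nBx] := pselect (B x); first by left.
  by right; apply: AN => /= AB; exact/nBx/AB.
apply: le_trans (outer_measureU2 _ _ _) _.
by rewrite [X in (_ + X)%E](_ : _ = 0%E) ?adde0.
Qed.

Lemma ae_neq0 : {ae (@leb R), forall x : R, x != 0}.
Proof.
exists ([set 0] : set (LebR R)); split.
- exact: lebesgue_of_borel.
- by rewrite -[LHS]/(lebesgue_measure [set 0 : R]) lebesgue_measure_set1.
- by move=> x /= /negP; rewrite negbK => /eqP.
Qed.

(** The point 0 is null and is discarded here once and for all: a rearrangement may be infinite
    there, and phi vanishes there. *)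
Lemma aeI_imp (P Q : R -> Prop) : (forall x, I x -> 0 < x -> P x -> Q x) ->
  aeI I P -> aeI I Q.
Proof.
move=> PQ; apply: filterS2 ae_neq0 => x x0 Px Ix.
by apply: PQ => //; [rewrite lt_neqAle eq_sym x0 I_ge0|exact: Px].
Qed.

Lemma aeI_imp2 (P Q S : R -> Prop) :
  (forall x, I x -> 0 < x -> P x -> Q x -> S x) -> aeI I P -> aeI I Q -> aeI I S.
Proof.
move=> PQS; rewrite /aeI => aP aQ; apply: filterS3 ae_neq0 aP aQ => x x0 Px Qx Ix.
by apply: PQS; [|rewrite lt_neqAle eq_sym x0 I_ge0|exact: Px|exact: Qx].
Qed.

Lemma aeI_pos (P : R -> Prop) : (forall x, I x -> 0 < x -> P x) -> aeI I P.
Proof.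
by move=> H; apply: (@aeI_imp (fun=> True)); [move=> x + + _; exact: H|apply: aeW].
Qed.

Implicit Types f g h u : R -> R.

Lemma distr_ge0 f s : (0 <= distr I f s)%E.
Proof. exact: outer_measure_ge0. Qed.

Lemma distr_ae_le f g s s' :
  aeI I (fun x => s < `|f x| -> s' < `|g x|) -> (distr I f s <= distr I g s')%E.
Proof.
rewrite /aeI => H; apply: leb_ae_subset; apply: filterS H => x H [Ix sf].
by split => //; exact: H.
Qed.

Lemma measurable_distr_set f s : lmeas I f ->
  measurable (I `&` [set x | s < `|f x|] : set (LebR R)).
Proof.
move=> mf.
have : lmeas I (fun x => `|f x|) by apply: measurableT_comp.
move=> /(_ (lebesgue_of_borel measurable_I) `]s, +oo[%classic (measurable_itv _)).
by congr (measurable _); congr (_ `&` _); apply/seteqP; split => x /=;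
  rewrite in_itv/= andbT.
Qed.

(** The sets |f| > s + 1/(n+1) increase to |f| > s, and the measure is continuous from below. *)
Lemma distr_right_continuous f s (c : \bar R) : lmeas I f ->
  (forall s', s < s' -> (distr I f s' <= c)%E) -> (distr I f s <= c)%E.
Proof.
move=> mf H.
pose F n : set (LebR R) := I `&` [set x | s + n.+1%:R^-1 < `|f x|].
have FE : \bigcup_n F n = (I `&` [set x | s < `|f x|] : set (LebR R)).
  apply/seteqP; split => [x [n _ [Ix sx]]|x [Ix sx]].
    by split => //=; apply: lt_trans sx; rewrite ltrDl invr_gt0.
  have := sx; rewrite /= -subr_gt0 => /ltr_add_invr[n]; rewrite add0r => sn.
  by exists n => //; split => //=; rewrite -ltrBrDl.
have mF n : measurable (F n) by exact: measurable_distr_set.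
have ndF : nondecreasing_seq F.
  move=> m n mn; apply/subsetPset => x [Ix sx]; split => //=.
  by apply: le_lt_trans sx; rewrite lerD2l lef_pV2 ?posrE// ler_nat.
have cF : leb (F n) @[n --> \oo] --> leb (\bigcup_n F n).
  apply: nondecreasing_cvg_mu => //; exact: bigcup_measurable.
rewrite /distr -FE -(cvg_lim _ cF)//; apply: lime_le.
  by apply/cvg_ex; exists (leb (\bigcup_n F n)).
by apply: nearW => n; apply: H; rewrite ltrDl invr_gt0.
Qed.

Lemma rearr_ge0 f t : (0 <= rearr I f t)%E.
Proof. by apply: le_ereal_inf_tmp => _ [s [s0 _] <-]; rewrite lee_fin. Qed.

(** The infimum defining the rearrangement is attained, because the distribution function is right
    continuous. This Galois connection is the tool behind most later facts on rearrangements. *)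
Lemma rearr_leP f s t : lmeas I f -> 0 <= s ->
  (rearr I f t <= s%:E)%E <-> (distr I f s <= t%:E)%E.
Proof.
move=> mf s0; split => [rs|ds].
  apply: distr_right_continuous => // s' ss'.
  have : (rearr I f t < s'%:E)%E by apply: le_lt_trans rs _; rewrite lte_fin.
  move=> /ereal_inf_lt[_ [r [r0 dr] <-]]; rewrite lte_fin => rs'.
  apply: le_trans dr; apply: distr_ae_le; apply: aeW => x _.
  exact: lt_trans.
by apply: ereal_inf_lbound; exists s.
Qed.

Lemma rearr_gtP f s t : lmeas I f -> 0 <= s ->
  (s%:E < rearr I f t)%E <-> (t%:E < distr I f s)%E.
Proof.
move=> mf s0; rewrite !ltNge; split => /negP H; apply/negP => H'; apply: H;
  exact/rearr_leP.
Qed.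

Lemma le_rearr f s t : s <= t -> (rearr I f t <= rearr I f s)%E.
Proof.
move=> st; apply: ereal_inf_le_tmp => _ [r [r0 dr] <-]; exists r => //.
by split => //; apply: le_trans dr _; rewrite lee_fin.
Qed.

(** With r = g^*(t), |f| > a r + b forces |g| > r, so the height a r + b is admissible for f. The
    shift b is what a bounded summand contributes. *)
Lemma rearr_le_affine f g a b t : lmeas I g -> 0 < a -> 0 <= b ->
  aeI I (fun x => `|f x| <= a * `|g x| + b) ->
  (rearr I f t <= a%:E * rearr I g t + b%:E)%E.
Proof.
move=> mg a0 b0 H.
have := rearr_ge0 g t; case E : (rearr I g t) => [r| |//]; last first.
  by move=> _; rewrite gt0_muley ?lte_fin// leey.
rewrite lee_fin => r0; rewrite -EFinM -EFinD; apply: ereal_inf_lbound.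
have ar0 : 0 <= a * r + b by rewrite addr_ge0// mulr_ge0// ltW.
exists (a * r + b) => //; split => //.
have : (distr I g r <= t%:E)%E by apply/rearr_leP => //; rewrite E.
apply: le_trans; apply: distr_ae_le; apply: aeI_imp H => x _ _ fg fr.
by move: (lt_le_trans fr fg); rewrite ltrD2r ltr_pM2l.
Qed.

Lemma rearr_ae_le f g t : lmeas I g -> aeI I (fun x => `|f x| <= `|g x|) ->
  (rearr I f t <= rearr I g t)%E.
Proof.
move=> mg H; rewrite -[leRHS]mul1e -[leRHS]adde0.
apply: rearr_le_affine => //; apply: aeI_imp H => x _ _.
by rewrite mul1r addr0.
Qed.

Lemma rearr_bounded f b t : 0 <= b -> 0 <= t -> aeI I (fun x => `|f x| <= b) ->
  (rearr I f t <= b%:E)%E.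
Proof.
rewrite /aeI => b0 t0 H; apply: ereal_inf_lbound; exists b => //; split => //.
apply: (@le_trans _ _ (leb (set0 : set (LebR R)))).
  apply: leb_ae_subset; apply: filterS H => x H [Ix].
  by rewrite /= ltNge H.
by rewrite measure0 lee_fin.
Qed.

Lemma leb_I_le t : I = `[0%R, 1%R]%classic -> (leb (I : set (LebR R)) <= t%:E)%E <-> 1 <= t.
Proof. by move=> ->; rewrite leb_itv/= lte_fin ltr01 -EFinB subr0 lee_fin. Qed.

Lemma distr_le_I f s y : 0 <= y -> (y%:E < distr I f s)%E -> I y.
Proof.
case: hI => E y0 yd; last by rewrite E /= in_itv/= y0.
rewrite E /= in_itv/= y0/= leNgt; apply/negP => y1.
have : (distr I f s <= y%:E)%E.
  apply: (@le_trans _ _ (leb (I : set (LebR R)))); first by apply: leb_subset => x [].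
  by apply/leb_I_le => //; exact: ltW.
by rewrite leNgt yd.
Qed.

(** Only points before t can exceed the height [h t]. At a jump of h the inequality may be strict,
    since rearrangements are right continuous. *)
Lemma nonincreasing_rearr_le h t : I t -> 0 < t ->
  (forall x, I x -> 0 < x -> 0 <= h x) ->
  (forall x y, I x -> I y -> 0 < x -> x <= y -> h y <= h x) ->
  (rearr I h t <= (h t)%:E)%E.
Proof.
move=> It t0 h0 hni; apply: ereal_inf_lbound; exists (h t) => //; split.
  exact: h0.
apply: (@le_trans _ _ (leb (`[0, t]%classic : set (LebR R)))).
  apply: leb_subset => x [Ix /= hx]; rewrite in_itv/= I_ge0//= leNgt.
  apply/negP => tx; move: hx; rewrite ltNge ger0_norm ?h0 ?(lt_trans t0)//.
  by rewrite hni// ltW.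
by rewrite leb_itv/= lte_fin t0 -EFinB subr0.
Qed.

Lemma rearrRE f t : (rearr I f t < +oo)%E -> (rearrR I f t)%:E = rearr I f t.
Proof. by move=> foo; rewrite fineK// ge0_fin_numE// rearr_ge0. Qed.

Lemma rearrR_ge0 f t : 0 <= rearrR I f t.
Proof. by apply: fine_ge0; exact: rearr_ge0. Qed.

Lemma le_rearrR f s t : (rearr I f s < +oo)%E -> s <= t ->
  rearrR I f t <= rearrR I f s.
Proof.
move=> foo st; rewrite -lee_fin !rearrRE//; first exact: le_rearr.
by apply: le_lt_trans foo; exact: le_rearr.
Qed.

Definition rearr_finite f := forall t, I t -> 0 < t -> (rearr I f t < +oo)%E.

(** By the Galois connection, s < f^*(x) means x < [distr I f s]; up to the null point 0, the set to
    be measured is therefore an initial interval truncated at t. *)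
Lemma distr_rearr_cut f t s : lmeas I f -> rearr_finite f -> 0 < t -> 0 <= s ->
  distr I (rearr_cut I f t) s = Order.min t%:E (distr I f s).
Proof.
move=> mf ff t0 s0.
pose A : set (LebR R) := [set y | [/\ 0 < y, y <= t & (y%:E < distr I f s)%E]].
have -> : distr I (rearr_cut I f t) s = leb A.
  have cutE x : I x -> 0 < x -> (s < `|rearr_cut I f t x|) <->
      x <= t /\ (x%:E < distr I f s)%E.
    move=> Ix x0; rewrite /rearr_cut indicE.
    have [/set_mem|] := boolP (x \in `[0, t]%classic); last first.
      move=> /negP H; rewrite mulr0 normr0 ltNge s0/=; split => // -[xt _].
      by exfalso; apply: H; rewrite inE/= in_itv/= ltW.
    rewrite /= in_itv/= mulr1 => /andP[_ xt].
    rewrite ger0_norm ?rearrR_ge0// -lte_fin rearrRE; last exact: ff.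
    by rewrite rearr_gtP//; split => [|[]//]; split.
  apply/eqP; rewrite eq_le; apply/andP; split; apply: leb_ae_subset;
      apply: filterS ae_neq0 => x xn0.
    move=> [Ix sx]; have x0 : 0 < x by rewrite lt_neqAle eq_sym xn0 I_ge0.
    by move/(cutE x Ix x0) : sx => [].
  move=> [x0 xt xd]; have Ix : I x by apply: distr_le_I xd; exact: ltW.
  by split => //; exact/cutE.
(* The right end point of [A] is t, included, or [distr I f s], excluded, whichever is smaller; the
   length is the same in both cases. *)
have ltE (b : R) (c : itv_bound R) : 0 <= b -> c = BLeft b \/ c = BRight b ->
    A = [set` Interval (BRight 0) c] -> leb A = b%:E.
  move=> b0 cE ->; rewrite leb_itv/=.
  by case: cE => -> /=; rewrite lte_fin; case: ltgtP b0 => // [b0|<-] _;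
    rewrite -?EFinB ?subr0.
have := distr_ge0 f s; case D : (distr I f s) => [d| |//] d0.
  rewrite lee_fin in d0; rewrite -EFin_min; have [td|dt] := ltP t d.
    apply: (ltE _ (BRight t)); [exact: ltW|by right|].
    apply/seteqP; split => x; rewrite /A /= in_itv/= D; first by move=> [-> ->].
    by move=> /andP[-> xt]; split => //; rewrite lte_fin (le_lt_trans xt).
  apply: (ltE _ (BLeft d)) => //; first by left.
  apply/seteqP; split => x; rewrite /A /= in_itv/= D lte_fin; first by move=> [-> _ ->].
  by move=> /andP[-> xd]; split => //; rewrite (le_trans _ dt)// ltW.
have -> : Order.min t%:E +oo%E = t%:E by rewrite minEle leey.
apply: (ltE _ (BRight t)); [exact: ltW|by right|].
apply/seteqP; split => x; rewrite /A /= in_itv/= D; first by move=> [-> ->].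
by move=> /andP[-> ->]; split => //; exact: ltry.
Qed.

Lemma nonincreasing_emeasurable (D : set R) (h : R -> \bar R) : is_interval D ->
  (forall x y, D x -> D y -> x <= y -> (h y <= h x)%E) -> measurable_fun D h.
Proof.
move=> iD hni.
apply: (measurability (@ErealGenCInfty.G R)) => [|/= _ [_] [r] -> <-//].
  exact: ErealGenCInfty.measurableE.
apply: is_interval_measurable => s t/= [Ds sr] [Dt tr] u /andP[su ut].
have Du : D u by apply: iD Ds Dt _ _; rewrite su.
split => //; move: tr; rewrite /= !in_itv/= !andbT => /le_trans; apply.
exact: hni.
Qed.

Lemma nonincreasing_on_measurable (D : set R) (h : R -> R) : is_interval D ->
  (forall x y, D x -> D y -> x <= y -> h y <= h x) -> measurable_fun D h.
Proof.
move=> iD hni; apply/measurable_EFinP; apply: nonincreasing_emeasurable => //.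
Qed.

Lemma nondecreasing_on_measurable (D : set R) (h : R -> R) : is_interval D ->
  (forall x y, D x -> D y -> x <= y -> h x <= h y) -> measurable_fun D h.
Proof.
move=> iD hnd; have -> : h = \- (\- h) by apply/funext => x /=; rewrite opprK.
apply: measurable_funN; apply: nonincreasing_on_measurable => // x y Dx Dy xy.
by rewrite lerN2 hnd.
Qed.

Lemma is_interval_I : is_interval I.
Proof. by case: hI => ->; exact: interval_is_interval. Qed.

Lemma measurable_rearr f (D : set R) : is_interval D -> measurable_fun D (rearr I f).
Proof. by move=> iD; apply: nonincreasing_emeasurable => // x y _ _; exact: le_rearr. Qed.

Lemma lmeas_rearrR f : lmeas I (rearrR I f).
Proof.
apply: lmeas_of_borel; first exact: measurable_I.
apply: (measurableT_comp (fine_measurable measurableT)).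
by apply: measurable_rearr; exact: is_interval_I.
Qed.

Lemma lmeas_rearr_cut f t : lmeas I (rearr_cut I f t).
Proof.
apply: measurable_funM; first exact: lmeas_rearrR.
by apply: (@measurable_indic _ (LebR R)); apply: lebesgue_of_borel; exact: measurable_itv.
Qed.

Lemma eq_ereal_lt (a b : \bar R) : (0 <= a)%E -> (0 <= b)%E ->
  (forall s, 0 <= s -> (s%:E < a)%E <-> (s%:E < b)%E) -> a = b.
Proof.
move=> a0 b0 H; apply/eqP; rewrite eq_le; apply/andP; split; rewrite leNgt; apply/negP.
  move=> ba; have bf : b \is a fin_num by rewrite ge0_fin_numE// (lt_le_trans ba)// leey.
  by have [+ _] := H _ (fine_ge0 b0); rewrite fineK// ltxx => /(_ ba).
move=> ab; have af : a \is a fin_num by rewrite ge0_fin_numE// (lt_le_trans ab)// leey.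
by have [_ +] := H _ (fine_ge0 a0); rewrite fineK// ltxx => /(_ ab).
Qed.

(** The value at x = t is 0 although the cut keeps the point t. Because of this strict inequality,
    cuts are compared below at points s < t, and the converse estimate cuts at 2 s. *)
Lemma rearr_cutE f t x : lmeas I f -> rearr_finite f -> 0 < t ->
  rearr I (rearr_cut I f t) x = if x < t then rearr I f x else 0%E.
Proof.
move=> mf ff t0; apply: eq_ereal_lt; [exact: rearr_ge0|by case: ifP => // _; exact: rearr_ge0|].
move=> s s0; rewrite rearr_gtP//; last exact: lmeas_rearr_cut.
rewrite distr_rearr_cut// lt_min lte_fin; case: ifP => xt /=.
  by rewrite rearr_gtP.
by rewrite lte_fin ltNge s0.
Qed.

Lemma Linfty_norm_leP f M : 0 <= M ->
  (Linfty_norm I f <= M%:E)%E <-> aeI I (fun x => `|f x| <= M).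
Proof.
move=> M0; rewrite /Linfty_norm /aeI; split => [/ess_supP|] H.
  apply: filterS H => x; rewrite patchE; case: ifPn => [xI|/negP xI] //= H Ix.
  by exfalso; apply: xI; rewrite inE.
apply/ess_supP; apply: filterS H => x H; rewrite patchE; case: ifPn => [/set_mem/H|] //.
Qed.

Lemma Linfty_norm_ge0 f : (0 <= Linfty_norm I f)%E.
Proof.
apply: ess_sup_gee; last by apply: aeW => x; rewrite patchE; case: ifP.
apply: (@lt_le_trans _ _ (leb (`[0%R, 1%R]%classic : set (LebR R)))).
  by rewrite leb_itv/= lte_fin ltr01 -EFinB subr0 lte_fin.
exact: leb_subset.
Qed.

Lemma LinftyP f : Linfty I f ->
  0 <= fnorm (Linfty I) f /\ aeI I (fun x => `|f x| <= fnorm (Linfty I) f).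
Proof.
move=> [mf foo]; have f0 := Linfty_norm_ge0 f.
have fin : Linfty_norm I f \is a fin_num by rewrite ge0_fin_numE.
have n0 : 0 <= fnorm (Linfty I) f by exact: fine_ge0.
by split => //; apply/Linfty_norm_leP => //; rewrite /= fineK.
Qed.

Lemma Linfty_bounded f M : lmeas I f -> 0 <= M -> aeI I (fun x => `|f x| <= M) ->
  Linfty I f /\ fnorm (Linfty I) f <= M.
Proof.
move=> mf M0 /Linfty_norm_leP-/(_ M0) H.
have oo : (Linfty_norm I f < +oo)%E by apply: le_lt_trans H (ltry _).
by split => //=; rewrite -lee_fin fineK// ge0_fin_numE// Linfty_norm_ge0.
Qed.
End Interval.

(** * The fundamental function and its Stieltjes measure *)

HB.instance Definition _ (R : realType) (I : set R) (X : banach_ri I) :=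
  Measure.on (dphi X).

Section Fundamental.
Context {R : realType} (I : set R).
Hypothesis hI : I = `[0%R, 1%R]%classic \/ I = `[0%R, +oo[%classic.
Context (X : banach_ri I) (hX : standard_fundamental I X).
Local Notation phi := (fundamental X).

Lemma phi_ge0 t : 0 <= phi t.
Proof. exact: (qn_ge0 (bri_normed X) (fundamental_mem X t)). Qed.

Lemma phi_le0 t : t <= 0 -> phi t = 0.
Proof.
move=> t0; apply/eqP; rewrite eq_le phi_ge0 andbT -(fund0 hX).
exact: fundamental_nondecreasing.
Qed.

(** Both indicators are 1 on I. Constancy beyond 1 lets inequalities such as [phi_double] be stated
    without staying inside I. *)
Lemma phi_clamp t : I = `[0%R, 1%R]%classic -> 1 <= t -> phi t = phi 1.
Proof.
move=> I1 t1; apply/eqP; rewrite eq_le (fundamental_nondecreasing X t1) andbT.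
have [] // := ri_ideal (bri_ri X) (fundamental_mem X 1) (@lmeas_indic_itv _ I t).
apply: aeW => x; rewrite I1 /= in_itv/= => /andP[x0 x1].
by rewrite !indicE !mem_set//= in_itv/= x0// (le_trans x1).
Qed.

Lemma phi_gt0 t : 0 < t -> 0 < phi t.
Proof.
move=> t0; have [It|nIt] := pselect (I t); first exact: fund_gt0 hX _ It t0.
case: hI => E; last by exfalso; apply: nIt; rewrite E /= in_itv/= ltW.
have t1 : 1 <= t.
  rewrite leNgt; apply/negP => t1; apply: nIt.
  by rewrite E /= in_itv/= !ltW.
rewrite phi_clamp//; apply: (fund_gt0 hX) => //.
by rewrite E /= in_itv/= lexx ler01.
Qed.

(** Cleared of denominators, so that [lra] can combine several instances. *)
Lemma phi_concave a b c : I a -> I c -> a <= b -> b <= c ->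
  (c - b) * phi a + (b - a) * phi c <= (c - a) * phi b.
Proof.
move=> Ia Ic ab bc; have := le_trans ab bc; rewrite le_eqVlt => /orP[/eqP ac|ac].
  have -> : b = a by apply/eqP; rewrite eq_le {1}ac bc.
  by rewrite ac !subrr !mul0r addr0.
have ca0 : 0 < c - a by rewrite subr_gt0.
have k0 : 0 <= (b - a) / (c - a) by rewrite divr_ge0 ?subr_ge0// ltW.
have k1 : (b - a) / (c - a) <= 1 by rewrite ler_pdivrMr// mul1r lerB.
set k := (b - a) / (c - a) in k0 k1.
have H : - phi (k * c + (1 - k) * a) <= k * - phi c + (1 - k) * - phi a :=
  fund_concave hX (Itv01 k0 k1) (mem_set Ic) (mem_set Ia).
move: H; have -> : k * c + (1 - k) * a = b.
  by rewrite /k; field; rewrite gt_eqF.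
rewrite /k.
set p := phi b; set q := phi c; set r := phi a.
rewrite -(ler_pM2l ca0).
have -> : (c - a) * ((b - a) / (c - a) * - q + (1 - (b - a) / (c - a)) * - r) =
  - ((c - b) * r + (b - a) * q) by field; rewrite gt_eqF.
by rewrite mulrN lerN2.
Qed.

(** Concavity between 0 and b with phi(0) = 0: slopes of chords from the origin decrease. *)
Lemma phi_quasiconcave a b : 0 < a -> a <= b -> a * phi b <= b * phi a.
Proof.
move=> a0 ab.
have main b' : I b' -> a <= b' -> a * phi b' <= b' * phi a.
  move=> Ib' ab'; have := phi_concave (I_0 hI) Ib' (ltW a0) ab'.
  by rewrite (fund0 hX) mulr0 add0r !subr0.
have [Ib|nIb] := pselect (I b); first exact: main.
case: hI => E; last first.
  by exfalso; apply: nIb; rewrite E /= in_itv/= andbT (le_trans (ltW a0)).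
have b1 : 1 <= b.
  rewrite leNgt; apply/negP => b1; apply: nIb.
  by rewrite E /= in_itv/= !ltW// (lt_le_trans a0).
rewrite (phi_clamp E b1); have [a1|/ltW a1] := leP a 1.
  apply: le_trans (_ : 1 * phi a <= _); last by rewrite ler_wpM2r// phi_ge0.
  by apply: main => //; rewrite E /= in_itv/= lexx ler01.
by rewrite (phi_clamp E a1) ler_wpM2r// phi_ge0.
Qed.

Lemma phi_double t : phi (2 * t) <= 2 * phi t.
Proof.
have [t0|t0] := leP t 0.
  by rewrite !phi_le0 ?mulr0// pmulr_rle0.
rewrite -(ler_pM2l t0) mulrCA mulrA; apply: phi_quasiconcave => //.
by rewrite ler_peMl ?ltW// ltr1n.
Qed.

Lemma phi_half t : phi t <= 2 * phi (t / 2).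
Proof. by have := phi_double (t / 2); rewrite [2 * (t / 2)]mulrC divfK. Qed.

Lemma phi_rcE t : 0 < t -> fundamental_rc X t = phi t.
Proof.
move=> t0; apply/eqP; rewrite eq_le; apply/andP; split; last first.
  apply: lb_le_inf; first by exists (phi (t + 1)), (t + 1) => //=;
    rewrite in_itv/= andbT ltrDl.
  by move=> _ [s /= + <-]; rewrite in_itv/= andbT => /ltW; exact: fundamental_nondecreasing.
apply/ler_addgt0Pr => e e0.
(* With this increment h, [phi_quasiconcave] gives phi(t + h) <= (t + h) phi(t) / t = phi(t) + e, so
   phi has no jump at t > 0. *)
have d0 : 0 < e * t / phi t by rewrite divr_gt0 ?mulr_gt0// phi_gt0.
apply: (@le_trans _ _ (phi (t + e * t / phi t))).
  apply: ge_inf; first by exists 0 => _ [s _ <-]; exact: phi_ge0.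
  by exists (t + e * t / phi t) => //=; rewrite in_itv/= andbT ltrDl.
rewrite -(ler_pM2l t0); apply: le_trans (phi_quasiconcave t0 _) _.
  by rewrite lerDl ltW.
have p0 := phi_gt0 t0.
suff -> : (t + e * t / phi t) * phi t = t * (phi t + e) by [].
by field; rewrite gt_eqF.
Qed.

Lemma phi_rc_lt0 t : t < 0 -> fundamental_rc X t = 0.
Proof.
move=> t0; apply/eqP; rewrite eq_le; apply/andP; split.
  apply: ge_inf; first by exists 0 => _ [s _ <-]; exact: phi_ge0.
  by exists 0; [rewrite /= in_itv/= t0|exact: (fund0 hX)].
apply: lb_le_inf; first by exists (phi (t + 1)), (t + 1) => //=;
  rewrite in_itv/= andbT ltrDl.
by move=> _ [s /= _ <-]; exact: phi_ge0.
Qed.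

Lemma dphi_oc a b : a <= b ->
  dphi X `]a, b]%classic = (fundamental_rc X b - fundamental_rc X a)%:E.
Proof.
move=> ab; rewrite /dphi /lebesgue_stieltjes_measure /measure_extension/=.
rewrite measurable_mu_extE/=; last by exists (a, b).
by rewrite wlength_itv_bnd.
Qed.

Lemma dphi_oc_pos a b : 0 < a -> a <= b ->
  dphi X `]a, b]%classic = (phi b - phi a)%:E.
Proof. by move=> a0 ab; rewrite dphi_oc// !phi_rcE// (lt_le_trans a0). Qed.

Lemma dphi_neg : dphi X `]-1, 0[%classic = 0%E.
Proof.
pose F n : set (measurableTypeR R) := `]-1, - n.+1%:R^-1]%classic.
apply/eqP; rewrite eq_le measure_ge0 andbT.
have FE : (`]-1, 0[%classic : set (measurableTypeR R)) `<=` \bigcup_n F n.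
  move=> x; rewrite /= in_itv/= => /andP[x1 x0].
  have : 0 < - x by rewrite oppr_gt0.
  move=> /ltr_add_invr[n]; rewrite add0r => nx.
  by exists n => //; rewrite /F /= in_itv/= x1/= lerNr ltW.
apply: le_trans (measure_sigma_subadditive _ _ _ FE) _ => //.
  by move=> n; exact: measurable_itv.
rewrite eseries0// => n _ _; rewrite /= /F dphi_oc.
  by rewrite !phi_rc_lt0 ?subrr// ?ltrN10// oppr_lt0.
by rewrite lerN2 invf_le1// ler1n.
Qed.

(** The Stieltjes measure is explicit on intervals open on the left; starting at -1 catches the atom
    at 0, as ]-1, 0[ has no mass. *)
Lemma dphi_cc t : 0 < t -> dphi X `[0, t]%classic = (phi t)%:E.
Proof.
move=> t0; have <- : dphi X `]-1, t]%classic = (phi t)%:E.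
  rewrite dphi_oc ?(phi_rcE t0)//; last by rewrite (le_trans _ (ltW t0))// lerN10.
  by rewrite phi_rc_lt0 ?subr0// ltrN10.
have -> : `]-1, t]%classic = `]-1, 0[%classic `|` `[0, t]%classic :> set R.
  by rewrite -itv_bndbnd_setU// bnd_simp ?ltrN10// ltW.
have disj : `]-1, 0[%classic `&` `[0, t]%classic = set0 :> set R.
  apply/seteqP; split => // x []; rewrite /= !in_itv/= => /andP[_ x0] /andP[+ _].
  by rewrite leNgt x0.
have mN : measurable (`]-1, 0[%classic : set R) by exact: measurable_itv.
have mP : measurable (`[0, t]%classic : set R) by exact: measurable_itv.
set N : set R := `]-1, 0[%classic in disj mN *.
set P : set R := `[0, t]%classic in disj mP *.
have : dphi X (N `|` P) = (dphi X N + dphi X P)%E := measureU (dphi X) mN mP disj.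
by rewrite dphi_neg add0e.
Qed.

Lemma dphi_le (A B : set R) : measurable A -> measurable B -> A `<=` B ->
  (dphi X A <= dphi X B)%E.
Proof. by move=> mA mB AB; apply: le_measure => //; rewrite inE. Qed.

(** The interval [0, t/2] lies in [0, t[ and has at least half the mass. The half-open form is the
    one in which superlevel sets of rearrangements arise. *)
Lemma phi_le_dphi_co t : 0 < t -> ((phi t)%:E <= 2%:E * dphi X `[0%R, t[%classic)%E.
Proof.
move=> t0; have t20 : 0 < t / 2 by rewrite divr_gt0.
apply: (@le_trans _ _ (2 * phi (t / 2))%:E); first by rewrite lee_fin phi_half.
rewrite EFinM -dphi_cc//.
rewrite lee_pmul2l//; apply: dphi_le; [exact: measurable_itv..|].
move=> x; rewrite /= !in_itv/= => /andP[-> xt]/=; apply: le_lt_trans xt _.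
by rewrite ltr_pdivrMr// ltr_pMr// ltr1n.
Qed.

(* A substitute for the derivative of [phi], comparable to it on average and
   nonincreasing on [I]; [weight_antitone] needs no differentiation theorem. *)
Definition weight (x : R) : R := 2 * (phi x - phi (x / 2)) / x.

Lemma weight_ge0 x : 0 < x -> 0 <= weight x.
Proof.
move=> x0; rewrite /weight divr_ge0 ?(ltW x0)// mulr_ge0// subr_ge0.
apply: fundamental_nondecreasing.
by rewrite ler_pdivrMr// ler_peMr ?ler1n// ltW.
Qed.

(** In other words, [weight x] is the mean slope of phi over [x/2, x]. *)
Lemma weightM x : 0 < x -> weight x * (x / 2) = phi x - phi (x / 2).
Proof. by move=> x0; rewrite /weight; field; rewrite gt_eqF. Qed.

(** Chord slopes of a concave function: passing from [y/2, y] to [x/2, y] and then to [x/2, x], the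
    slope can only grow. *)
Lemma weight_antitone x y : I y -> 0 < x -> x <= y -> weight y <= weight x.
Proof.
move=> Iy x0 xy; have y0 : 0 < y by exact: lt_le_trans xy.
have Ix2 : I (x / 2).
  by apply: (I_down hI Iy); [rewrite divr_ge0// ltW|lra].
rewrite /weight ler_pdivrMr// mulrAC ler_pdivlMr//.
have h1 : x / 2 <= y / 2 by lra. have h2 : y / 2 <= y by lra.
have := phi_concave Ix2 Iy h1 h2.
have h3 : x / 2 <= x by lra.
have := phi_concave Ix2 Iy h3 xy.
set A := phi (x / 2); set B := phi x; set C := phi (y / 2); set D := phi y => H2 H1.
have yx : 0 < y - x / 2 by lra.
rewrite -(ler_pM2l yx).
have e1 : x * ((y - x / 2) * (D - C)) <= x * (y / 2 * (D - A)).
  by rewrite ler_pM2l//; lra.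
have e2 : y * (x / 2 * (D - A)) <= y * ((y - x / 2) * (B - A)).
  by rewrite ler_pM2l//; lra.
lra.
Qed.

Lemma measurable_weight t : I t -> measurable_fun `]0, t]%classic weight.
Proof.
move=> It; apply: nonincreasing_on_measurable.
  exact: interval_is_interval.
move=> x y; rewrite /= !in_itv/= => /andP[x0 _] /andP[_ yt] xy.
apply: weight_antitone => //; apply: (I_down hI It) yt.
by rewrite ltW// (lt_le_trans x0).
Qed.

(** The slope over [t/2, t] is at most the slope over [t/4, t/2], and the first interval is twice as
    long. *)
Lemma phi_increment t : I t -> 0 < t ->
  phi t - phi (t / 2) <= 2 * (phi (t / 2) - phi (t / 2 / 2)).
Proof.
move=> It t0.
have It4 : I (t / 2 / 2) by apply: (I_down hI It); lra.
have h1 : t / 2 / 2 <= t / 2 by lra. have h2 : t / 2 <= t by lra.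
have := phi_concave It4 It h1 h2.
set A := phi (t / 2 / 2); set B := phi (t / 2); set C := phi t => H.
have t40 : 0 < t / 4 by lra.
by rewrite -(ler_pM2l t40); lra.
Qed.

End Fundamental.

(** * Layer-cake sums *)

Section GenericIntegral.
Context d (T : measurableType d) (R : realType) (mu : {measure set T -> \bar R}).
Local Open Scope ereal_scope.

Lemma integral_le_cst (D : set T) (f : T -> \bar R) (M : R) : measurable D ->
  measurable_fun D f -> (forall x, D x -> 0 <= f x <= M%:E) -> (0 <= M)%R ->
  \int[mu]_(x in D) f x <= M%:E * mu D.
Proof.
move=> mD mf fM M0; rewrite -integral_cst//; apply: ge0_le_integral => //.
- by move=> x /fM /andP[].
- by move=> x /fM /andP[].
Qed.

Lemma integral_ge_cst (D : set T) (f : T -> \bar R) (M : R) : measurable D ->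
  measurable_fun D f -> (forall x, D x -> M%:E <= f x) -> (0 <= M)%R ->
  M%:E * mu D <= \int[mu]_(x in D) f x.
Proof.
move=> mD mf fM M0; rewrite -integral_cst//; by apply: ge0_le_integral.
Qed.

Lemma nneseries_le (u : nat -> \bar R) c : (forall n, 0 <= u n) ->
  (forall N, \sum_(0 <= k < N) u k <= c) -> \sum_(k <oo) u k <= c.
Proof.
move=> u0 uc; apply: lime_le; first exact: is_cvg_nneseries.
exact: nearW.
Qed.

Definition superlevel (h : T -> \bar R) (s : R) : set T :=
  [set y | s%:E < h y].

(** For h >= 0 this rounds h up to a multiple of e. A series over the levels n e stands in for the
    layer-cake integral, so that only a sum and an integral are exchanged. *)
Definition layers (e : R) (h : T -> \bar R) (x : T) : \bar R :=
  \sum_(n <oo) (e * \1_(superlevel h (n%:R * e)) x)%:E.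

Lemma layers_ge0 e h x : (0 < e)%R -> 0 <= layers e h x.
Proof. by move=> e0; apply: nneseries_ge0 => n _ _; rewrite lee_fin mulr_ge0// ltW. Qed.

Lemma layers_ge e h x : (0 < e)%R -> h x <= layers e h x.
Proof.
move=> e0.
(* As long as N e stays below h x, each of the first N layers contributes e; afterwards h x is
   already reached. *)
have partial_ge N : Order.min (N%:R * e)%:E (h x) <=
    \sum_(0 <= n < N) (e * \1_(superlevel h (n%:R * e)) x)%:E.
  elim: N => [|N IH]; first by rewrite big_nil mul0r ge_min lexx.
  rewrite big_nat_recr//=; have [Nh|hN] := ltP (N%:R * e)%:E (h x).
    rewrite indicE mem_set//= mulr1.
    move: IH; rewrite (min_idPl (ltW Nh)) => IH.
    rewrite ge_min -[(N.+1)%:R]natr1 mulrDl mul1r EFinD; apply/orP; left.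
    exact: leeD2r.
  apply: (@le_trans _ _ (h x)); first by rewrite ge_min lexx orbT.
  by move: IH; rewrite (min_idPr hN) => /le_trans; apply; rewrite leeDl// lee_fin mulr_ge0// ltW.
have pos n : 0 <= (e * \1_(superlevel h (n%:R * e)) x)%:E.
  by rewrite lee_fin mulr_ge0// ltW.
have ser N : Order.min (N%:R * e)%:E (h x) <= layers e h x.
  by apply: le_trans (partial_ge N) _; exact: nneseries_lim_ge.
have [//|lh] := leP (h x) (layers e h x).
have lf : layers e h x \is a fin_num.
  by rewrite ge0_fin_numE ?layers_ge0// (lt_le_trans lh)// leey.
(* If the layers were below h x they would be finite, and N e exceeds them: both terms of the
   minimum in [ser] are then too large. *)
pose N := Num.bound (fine (layers e h x) / e)%R.
have := ser N; rewrite ge_min => /orP[|]; last by rewrite leNgt lh.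
rewrite -(fineK lf) lee_fin -ler_pdivlMr// leNgt => /negP[].
by apply: archi_boundP; rewrite divr_ge0 ?fine_ge0 ?layers_ge0 ?(ltW e0).
Qed.

Lemma layers_le e h x : (0 < e)%R -> 0 <= h x -> layers e h x <= h x + e%:E.
Proof.
move=> e0 h0.
have pos n : 0 <= (e * \1_(superlevel h (n%:R * e)) x)%:E.
  by rewrite lee_fin mulr_ge0// ltW.
apply: nneseries_le => // N.
elim: N => [|N IH]; first by rewrite big_nil adde_ge0// lee_fin ltW.
rewrite big_nat_recr//=; have [Nh|hN] := ltP (N%:R * e)%:E (h x); last first.
  by rewrite indicE memNset ?mulr0 ?adde0// /superlevel /= ltNge hN.
rewrite indicE mem_set//= mulr1 leeD2r//; apply: le_trans (ltW Nh).
elim: {IH Nh} N => [|N IH]; first by rewrite big_nil mul0r.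
rewrite big_nat_recr//= -[(N.+1)%:R]natr1 mulrDl mul1r EFinD leeD//.
by rewrite lee_fin ler_piMr ?(ltW e0)// indicE; case: (_ \in _).
Qed.

Lemma integral_layers (D : set T) e h (w : T -> R) : measurable D ->
  measurable_fun D h -> measurable_fun D w -> (forall x, D x -> (0 <= w x)%R) ->
  (0 < e)%R ->
  \int[mu]_(x in D) (layers e h x * (w x)%:E) =
  \sum_(n <oo) e%:E * \int[mu]_(x in D `&` superlevel h (n%:R * e)) (w x)%:E.
Proof.
move=> mD mh mw w0 e0.
pose A n : set T := superlevel h (n%:R * e).
have mA n : measurable (D `&` A n).
  have := mh mD `](n%:R * e)%:E, +oo[%classic (emeasurable_itv _).
  by congr (measurable _); apply/seteqP; split => x /=; rewrite /A /= /superlevel /= in_itv/= ?andbT.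
have m1 n : measurable_fun D (\1_(A n) : T -> R).
  apply: (eq_measurable_fun (\1_(D `&` A n) : T -> R)); last exact: measurable_indic.
  by move=> x xD; rewrite !indicE in_setI xD.
transitivity (\int[mu]_(x in D) \sum_(n <oo) (e%:E * (\1_(A n) x * w x)%:E)).
  apply: eq_integral => x /set_mem Dx; rewrite /layers muleC -nneseriesZl.
    by apply: eq_eseriesr => n _; rewrite -!EFinM mulrCA [(w x * _)%R]mulrC.
  by move=> n _; rewrite lee_fin mulr_ge0// ltW.
have mAw n : measurable_fun D (fun x => (\1_(A n) x * w x)%:E).
  by apply/measurable_EFinP; apply: measurable_funM.
rewrite integral_nneseries//.
- apply: eq_eseriesr => n _; rewrite ge0_integralZl_EFin//; last exact: ltW.
    rewrite integral_mkcondr; congr (_ * _); apply: eq_integral => x _.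
    by rewrite patchE indicE; case: ifP => _; rewrite ?mul1r ?mul0r.
  by move=> x Dx; rewrite lee_fin mulr_ge0// w0.
- by move=> n; exact: measurable_funeM.
- by move=> n x Dx; rewrite -EFinM lee_fin !mulr_ge0// ?w0// ltW.
Qed.

Lemma measurable_layers (D : set T) e h : (0 < e)%R -> measurable D ->
  measurable_fun D h -> measurable_fun D (layers e h).
Proof.
move=> e0 mD mh; apply: ge0_emeasurable_sum => n.
  by move=> x _ _; rewrite lee_fin mulr_ge0// ltW.
move=> _; apply/measurable_EFinP; apply: measurable_funM => //.
apply: (eq_measurable_fun (\1_(D `&` superlevel h (n%:R * e)) : T -> R)).
  by move=> x xD; rewrite !indicE in_setI xD.
apply: measurable_indic.
have := mh mD `](n%:R * e)%:E, +oo[%classic (emeasurable_itv _).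
by congr (measurable _); apply/seteqP; split => x /=; rewrite /superlevel /= in_itv/= ?andbT.
Qed.

Lemma integral_le_layers (D : set T) e h (w : T -> R) : measurable D ->
  measurable_fun D h -> (forall x, D x -> 0 <= h x) ->
  measurable_fun D w -> (forall x, D x -> (0 <= w x)%R) -> (0 < e)%R ->
  \int[mu]_(x in D) (h x * (w x)%:E) <=
  \sum_(n <oo) e%:E * \int[mu]_(x in D `&` superlevel h (n%:R * e)) (w x)%:E.
Proof.
move=> mD mh h0 mw w0 e0; rewrite -integral_layers//.
have mw' : measurable_fun D (EFin \o w) by exact/measurable_EFinP.
apply: ge0_le_integral => //.
- by move=> x Dx; rewrite mule_ge0 ?h0// lee_fin w0.
- exact: emeasurable_funM.
- by apply: emeasurable_funM => //; exact: measurable_layers.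
- by move=> x Dx; rewrite lee_wpmul2r ?lee_fin ?w0// layers_ge.
Qed.

(** The term e mu(D) is the rounding error of [layers_le]; [integral_le_layers], in the other
    direction, has none. *)
Lemma layers_le_integral (D : set T) e h : measurable D ->
  measurable_fun D h -> (forall x, D x -> 0 <= h x) -> (0 < e)%R ->
  \sum_(n <oo) e%:E * mu (D `&` superlevel h (n%:R * e)) <=
  \int[mu]_(x in D) h x + e%:E * mu D.
Proof.
move=> mD mh h0 e0.
have -> : \sum_(n <oo) e%:E * mu (D `&` superlevel h (n%:R * e)) =
    \int[mu]_(x in D) (layers e h x * (cst 1%R x)%:E).
  rewrite integral_layers//; apply: eq_eseriesr => n _; congr (_ * _).
  rewrite (integral_cst mu _ 1%:E) ?mul1e//.
  have := mh mD `](n%:R * e)%:E, +oo[%classic (emeasurable_itv _).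
  by congr (measurable _); apply/seteqP; split => x /=; rewrite /superlevel /= in_itv/= ?andbT.
rewrite -integral_cst// -ge0_integralD//; last by move=> x _; rewrite lee_fin ltW.
apply: ge0_le_integral => //.
- by move=> x _; rewrite mule1; exact: layers_ge0.
- apply: emeasurable_funM; first exact: measurable_layers.
  by apply/measurable_EFinP; exact: measurable_cst.
- exact: emeasurable_funD.
- by move=> x Dx; rewrite mule1; exact: layers_le (h0 _ Dx).
Qed.

End GenericIntegral.

(** * A Hardy-Littlewood inequality *)

Section WeightedIntegrals.
Context {R : realType} (I : set R).
Hypothesis hI : I = `[0%R, 1%R]%classic \/ I = `[0%R, +oo[%classic.
Context (X : banach_ri I) (hX : standard_fundamental I X).
Local Notation phi := (fundamental X).
Local Notation w := (weight X).

Definition dyadic (t : R) (k : nat) : set R := `]t / 2 ^+ k.+1, t / 2 ^+ k]%classic.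

Lemma measurable_dyadic t k : measurable (dyadic t k).
Proof. exact: measurable_itv. Qed.

Lemma bigcup_dyadic t : \bigcup_k dyadic t k = `]0, t]%classic.
Proof.
apply/seteqP; split => [x [k _]|x]; rewrite /dyadic /= !in_itv/=.
  move=> /andP[kx xk]; have t0 : 0 < t.
    rewrite ltNge; apply/negP => t0.
    have := lt_le_trans kx xk; rewrite ltNge => /negP; apply.
    rewrite ler_wnM2l// lef_pV2 ?posrE ?exprn_gt0//.
    by rewrite ler_eXn2l ?ltr1n.
  rewrite (lt_trans _ kx) ?divr_gt0 ?exprn_gt0//=.
  by rewrite (le_trans xk)// ler_pdivrMr ?exprn_gt0// ler_peMr ?(ltW t0)// exprn_ege1// ler1n.
move=> /andP[x0 xt].
have ex : exists n, t / 2 ^+ n.+1 < x.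
  exists (Num.bound (t / x)).
  rewrite ltr_pdivrMr ?exprn_gt0// mulrC -ltr_pdivrMr//.
  have := archi_boundP (divr_ge0 (le_trans (ltW x0) xt) (ltW x0)).
  move=> /lt_le_trans; apply; rewrite -natrX ler_nat.
  by apply: ltnW; apply: ltn_trans (ltnSn _) _; exact: ltn_expl.
case: (ex_minnP ex) => k tkx kmin; exists k => //; rewrite /= in_itv/= tkx/=.
case: k tkx kmin => [|k] tkx kmin; first by rewrite expr0 divr1.
by rewrite leNgt; apply/negP => /kmin; rewrite ltnn.
Qed.

Lemma trivIset_dyadic t : 0 < t -> trivIset setT (dyadic t).
Proof.
move=> t0; apply: ltn_trivIset => i j ij.
apply/seteqP; split => // x []; rewrite /dyadic /= !in_itv/= => /andP[jx xj] /andP[ix xi].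
have : t / 2 ^+ i <= t / 2 ^+ j.+1.
  by rewrite ler_pM2l// lef_pV2 ?posrE ?exprn_gt0// ler_eXn2l ?ltr1n.
by move=> /(le_trans xi)/le_lt_trans/(_ jx); rewrite ltxx.
Qed.

Lemma subset_dyadic t k : dyadic t k `<=` `]0, t]%classic.
Proof. by rewrite -bigcup_dyadic; exact: bigcup_sup. Qed.

Lemma leb_oc (a b : R) : a <= b -> leb (`]a, b]%classic : set (LebR R)) = (b - a)%:E.
Proof.
move=> ab; rewrite leb_itv/= lte_fin -EFinB; case: ltP => // ba.
by congr (_%:E); lra.
Qed.

Lemma leb_dyadic t k : 0 <= t ->
  leb (dyadic t k : set (LebR R)) = (t / 2 ^+ k / 2)%:E.
Proof.
move=> t0; have h : 0 <= t / 2 ^+ k by rewrite divr_ge0// exprn_ge0.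
have e : t / 2 ^+ k.+1 = t / 2 ^+ k / 2.
  by rewrite exprS invfM mulrCA mulrC.
rewrite /dyadic leb_oc e; last lra.
by congr (_%:E); lra.
Qed.

Lemma lmeas_weight t : I t -> lmeas `]0, t]%classic w.
Proof. by move=> It; apply: lmeas_of_borel => //; exact: measurable_weight. Qed.

Lemma pos_I t k : I t -> 0 < t -> 0 < t / 2 ^+ k /\ I (t / 2 ^+ k).
Proof.
move=> It t0; have h : 0 < t / 2 ^+ k by rewrite divr_gt0// exprn_gt0.
split => //; apply: (I_down hI It); first exact: ltW.
by rewrite ler_pdivrMr ?exprn_gt0// ler_peMr ?(ltW t0)// exprn_ege1// ler1n.
Qed.

Lemma measurable_fun_subl (A B : set R) (f : R -> R) : A `<=` B ->
  measurable A -> measurable B -> lmeas B f ->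
  measurable_fun (A : set (LebR R)) (EFin \o f).
Proof.
move=> AB mA mB mf; apply/measurable_EFinP.
by apply: measurable_funS mf => //; exact: lebesgue_of_borel.
Qed.

(** The weight may be unbounded at 0, so it is bounded block by block by its value at the left end a
    of the block. The block has length a, and a w(a) = 2 (phi(a) - phi(a/2)); the sum telescopes to
    at most 2 phi(t/2). *)
Lemma integral_weight_le t : I t -> 0 < t ->
  (\int[@leb R]_(x in (`]0%R, t]%classic : set (LebR R))) (w x)%:E <= (2 * phi t)%:E)%E.
Proof.
move=> It t0; have mw := lmeas_weight It.
rewrite -bigcup_dyadic ge0_integral_bigcup; last first.
- exact: trivIset_dyadic.
- move=> x [k _] /subset_dyadic; rewrite /= in_itv/= => /andP[x0 _].
  by rewrite lee_fin weight_ge0.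
- by rewrite bigcup_dyadic; exact/measurable_EFinP.
- by move=> k; apply: lebesgue_of_borel; exact: measurable_dyadic.
have term_le k : (\int[@leb R]_(x in (dyadic t k : set (LebR R))) (w x)%:E <=
    (2 * (phi (t / 2 ^+ k.+1) - phi (t / 2 ^+ k.+2)))%:E)%E.
  have [a0 Ia] := pos_I k.+1 It t0.
  apply: (@le_trans _ _ ((w (t / 2 ^+ k.+1))%:E * leb (dyadic t k : set (LebR R)))%E).
    apply: integral_le_cst.
    - by apply: lebesgue_of_borel; exact: measurable_dyadic.
    - apply: (measurable_fun_subl (B := `]0, t]%classic)) => //; first exact: subset_dyadic.
      exact: measurable_dyadic.
    - move=> x xk; have := subset_dyadic xk; rewrite /= in_itv/= => /andP[x0 xt].
      move: xk; rewrite /dyadic /= in_itv/= => /andP[/ltW kx _].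
      rewrite !lee_fin weight_ge0//= weight_antitone//.
      by apply: (I_down hI It) => //; exact: ltW.
    - exact: weight_ge0.
  rewrite leb_dyadic ?(ltW t0)// -EFinM lee_fin.
    have e n : t / 2 ^+ n.+1 = t / 2 ^+ n / 2 by rewrite exprS invfM mulrCA mulrC.
    have := weightM X a0; rewrite [in phi (_ / 2 ^+ k.+2)]e; set b := _ - _ => <-.
    by rewrite -e; lra.
apply: nneseries_le => [k|N].
  apply: integral_ge0 => x /subset_dyadic; rewrite /= in_itv/= => /andP[x0 _].
  by rewrite lee_fin weight_ge0.
apply: (@le_trans _ _ (2 * (phi (t / 2) - phi (t / 2 ^+ N.+1)))%:E); last first.
  rewrite lee_fin ler_pM2l//; have := phi_ge0 X (t / 2 ^+ N.+1).
  have : phi (t / 2) <= phi t by apply: fundamental_nondecreasing; lra.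
  lra.
elim: N => [|N IH]; first by rewrite big_nil expr1 subrr mulr0.
rewrite big_nat_recr//=; apply: le_trans (leeD IH (term_le N)) _.
by rewrite -EFinD lee_fin; lra.
Qed.

(** A coarse bathtub principle: the weight decreases, so a set of measure m is placed best near 0.
    The part inside ]0, m] and the part beyond m, where m w(m) <= 2 phi(m), cost 2 phi(m) each. *)
Lemma integral_weight_set_le (E : set R) t m : I t ->
  measurable (E : set (LebR R)) -> E `<=` `]0, t]%classic -> 0 < m -> m <= t ->
  (leb (E : set (LebR R)) <= m%:E)%E ->
  (\int[@leb R]_(x in (E : set (LebR R))) (w x)%:E <= (4 * phi m)%:E)%E.
Proof.
move=> It mE Et m0 mt Em; have Im : I m by apply: (I_down hI It) => //; exact: ltW.
have mw := lmeas_weight It.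
have w0 x : E x -> (0 <= (w x)%:E)%E.
  by move/Et; rewrite /= in_itv/= => /andP[x0 _]; rewrite lee_fin weight_ge0.
pose A : set (LebR R) := E `&` `]0, m]%classic.
pose B : set (LebR R) := E `&` `]m, t]%classic.
have mA : measurable A by apply: measurableI => //; apply: lebesgue_of_borel; exact: measurable_itv.
have mB : measurable B by apply: measurableI => //; apply: lebesgue_of_borel; exact: measurable_itv.
have mEw : measurable_fun (E : set (LebR R)) (EFin \o w).
  apply/measurable_EFinP; apply: measurable_funS mw => //.
  by apply: lebesgue_of_borel; exact: measurable_itv.
have EAB : E = A `|` B.
  rewrite -setIUr; apply/esym/setIidPl => x /Et; rewrite /= !in_itv/= => /andP[-> ->].
  by case: (leP x m) => /=; [left|right].
rewrite EAB in mEw w0 *; rewrite ge0_integral_setU//; last first.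
  apply/disj_setPS => x [[_ +] [_ +]]; rewrite /= !in_itv/= => /andP[_ xm] /andP[+ _].
  by rewrite ltNge xm.
have -> : (4 * phi m)%:E = ((2 * phi m)%:E + (2 * phi m)%:E)%E.
  by rewrite -EFinD; congr (_%:E); lra.
(* On [A] the full mass of [`]0, m]] is an upper bound; on [B], [w <= w m]. *)
apply: leeD.
  apply: le_trans (integral_weight_le Im m0); apply: ge0_subset_integral.
  - exact: mA.
  - by apply: lebesgue_of_borel; exact: measurable_itv.
  - exact/measurable_EFinP/lmeas_weight.
  - by move=> x; rewrite /= in_itv/= => /andP[x0 _]; rewrite lee_fin weight_ge0.
- by move=> x [].
apply: (@le_trans _ _ ((w m)%:E * leb B)%E).
  apply: integral_le_cst.
  - exact: mB.
  - by apply: measurable_funS mEw; [rewrite -EAB|exact: subsetUr].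
  - move=> x Bx; rewrite w0/=; last by right.
    case: Bx => Ex; rewrite /= in_itv/= => /andP[mx xt].
    rewrite lee_fin weight_antitone//; last exact: ltW.
    by apply: (I_down hI It) => //; rewrite ltW// (lt_trans m0).
  - exact: weight_ge0.
apply: (@le_trans _ _ ((w m)%:E * m%:E)%E).
  rewrite lee_wpmul2l ?lee_fin ?weight_ge0//; apply: le_trans Em.
  by apply: leb_subset => x [].
rewrite -EFinM lee_fin.
have := weightM X m0; have := phi_ge0 X (m / 2); lra.
Qed.


(** One layer of the Hardy-Littlewood inequality. If m is the measure of the set on the left, f^*
    exceeds s on [0, m[, whose [dphi]-mass is at least phi(m)/2; hence 8 = 4 * 2. *)
Lemma integral_weight_superlevel_le f t s : lmeas I f -> I t -> 0 < t -> 0 <= s ->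
  (\int[@leb R]_(x in (`]0%R, t]%classic `&` [set x | s < `|f x|%R]%R : set (LebR R))) (w x)%:E <=
   8%:E * dphi X (`[0%R, t]%classic `&` superlevel (rearr I f) s))%E.
Proof.
move=> mf It t0 s0; pose E : set (LebR R) := `]0, t]%classic `&` [set x | s < `|f x|].
rewrite -[X in (\int[_]_(x in X) _)%E]/E.
have mE : measurable E.
  have -> : E = `]0, t]%classic `&` (I `&` [set x | s < `|f x|]).
    rewrite setIA; congr (_ `&` _); apply/esym/setIidPl.
    exact: (subset_itv_I hI (b := false)).
  apply: measurableI; first by apply: lebesgue_of_borel; exact: measurable_itv.
  exact: measurable_distr_set.
have ED : (leb E <= distr I f s)%E.
  apply: leb_subset => x [xt sf]; split => //.
  by apply: (subset_itv_I hI It) xt.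
have Et : (leb E <= t%:E)%E.
  have := @leb_oc 0 t (ltW t0); rewrite subr0 => <-.
  by apply: leb_subset => x [].
have Efin : leb E \is a fin_num.
  by rewrite ge0_fin_numE ?outer_measure_ge0// (le_lt_trans Et)// ltry.
have msup : measurable (`[0%R, t]%classic `&` superlevel (rearr I f) s).
  have := @measurable_rearr _ I f `[0, t]%classic (@interval_is_interval _ _).
  move=> /(_ (measurable_itv _) `]s%:E, +oo[%classic (emeasurable_itv _)).
  by congr (measurable _); apply/seteqP; split => x; rewrite /superlevel /= !in_itv/= andbT.
(* A null set is treated apart, since the bathtub bound needs m > 0 and [0, m[ would be empty. *)
have := fine_ge0 (outer_measure_ge0 (@leb R) E); rewrite le_eqVlt => /orP[/eqP m0|m0].
  have E0 : leb E = 0%E by rewrite -(fineK Efin) -m0.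
  rewrite null_set_integral; [by rewrite mule_ge0|exact: mE| |exact: E0].
  apply: measurable_funS (_ : measurable_fun (`]0%R, t]%classic : set (LebR R)) _).
  - by apply: lebesgue_of_borel; exact: measurable_itv.
  - by move=> x [].
  - by apply/measurable_EFinP; exact: lmeas_weight.
set m := fine (leb E) in m0.
have Em : leb E = m%:E by rewrite fineK.
have mt : m <= t by rewrite -lee_fin -Em.
apply: (@le_trans _ _ (4 * phi m)%:E).
  apply: (integral_weight_set_le It) => //; [by move=> x []|by rewrite Em].
have -> : (4 * phi m)%:E = (4%:E * (phi m)%:E)%E by rewrite EFinM.
have -> : 8%:E = (4%:E * 2%:E)%E :> \bar R by rewrite -EFinM; congr (_%:E); lra.
rewrite -muleA lee_pmul2l//; apply: le_trans (phi_le_dphi_co hI hX m0) _.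
rewrite lee_pmul2l//; apply: dphi_le; [exact: (measurable_itv `[0, m[)|exact: msup|].
move=> x; rewrite /= in_itv/= => /andP[x0 xm]; split.
  by rewrite /= in_itv/= x0 ltW// (lt_le_trans xm).
apply/(rearr_gtP hI) => //; apply: lt_le_trans ED.
by rewrite Em lte_fin.
Qed.

Lemma integral_weight_le_rearr f t : lmeas I f -> I t -> 0 < t ->
  (\int[@leb R]_(x in (`]0%R, t]%classic : set (LebR R))) (`|f x| * w x)%:E <=
   8%:E * \int[dphi X]_(x in `[0%R, t]) rearr I f x)%E.
Proof.
move=> mf It t0; apply/lee_addgt0Pr => e e0.
have p0 := phi_gt0 hI hX t0.
(* The mesh for which the rounding error 8 d phi(t) of the layers is e. *)
pose d := e / (8 * phi t); have d0 : 0 < d by rewrite divr_gt0// mulr_gt0.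
have mI : measurable (`]0, t]%classic : set (LebR R)).
  by apply: lebesgue_of_borel; exact: measurable_itv.
have mf' : measurable_fun (`]0, t]%classic : set (LebR R)) f.
  apply: measurable_funS mf; first exact: lebesgue_of_borel (measurable_I hI).
  exact: (subset_itv_I hI (b := false)).
apply: (@le_trans _ _ (\int[@leb R]_(x in (`]0%R, t]%classic : set (LebR R)))
    ((`|f x|)%:E * (w x)%:E))%E); first by [].
apply: le_trans (integral_le_layers (leb : {measure set (LebR R) -> \bar R}) mI _ _ _ _ d0) _.
- by apply/measurable_EFinP; apply: measurableT_comp.
- by move=> x _; rewrite lee_fin.
- exact: lmeas_weight.
- by move=> x; rewrite /= in_itv/= => /andP[x0 _]; exact: weight_ge0.
apply: (@le_trans _ _ (8%:E * \sum_(n <oo)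
   (d%:E * dphi X (`[0%R, t]%classic `&` superlevel (rearr I f) (n%:R * d)))))%E.
  rewrite -nneseriesZl; last by move=> n _; rewrite mule_ge0// lee_fin ltW.
  apply: lee_nneseries => n _.
    move=> _; rewrite mule_ge0 ?lee_fin ?(ltW d0)//; apply: integral_ge0.
    by move=> x [+ _]; rewrite /= in_itv/= lee_fin => /andP[x0 _]; exact: weight_ge0.
  rewrite muleCA lee_pmul2l//.
  by apply: integral_weight_superlevel_le => //; rewrite mulr_ge0// ltW.
have -> : (e%:E = 8%:E * (d%:E * dphi X `[0%R, t]%classic))%E.
  rewrite dphi_cc// -!EFinM; congr (_%:E).
  by rewrite /d; field; rewrite gt_eqF.
rewrite -ge0_muleDr; last 2 first.
- by apply: integral_ge0 => x _; exact: rearr_ge0.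
- by rewrite mule_ge0// lee_fin ltW.
rewrite lee_pmul2l//; apply: layers_le_integral => //.
  by apply: measurable_rearr; exact: interval_is_interval.
by move=> x _; exact: rearr_ge0.
Qed.

Lemma integral_dphi_le_weight f t : I t -> 0 < t ->
  (forall x, I x -> 0 < x -> 0 <= f x) ->
  (forall x y, I x -> I y -> 0 < x -> x <= y -> f y <= f x) ->
  (\int[dphi X]_(x in `]0%R, t]) (f x)%:E <=
   2%:E * \int[@leb R]_(x in (`]0%R, t]%classic : set (LebR R))) (f x * w x)%:E)%E.
Proof.
move=> It t0 f0 fni.
have mf : measurable_fun `]0, t]%classic f.
  apply: nonincreasing_on_measurable; first exact: interval_is_interval.
  move=> x y; rewrite /= !in_itv/= => /andP[x0 xt] /andP[y0 yt] xy.
  by apply: fni => //; apply: (I_down hI It) => //; exact: ltW.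
have fpos x : `]0, t]%classic x -> 0 < x /\ I x.
  rewrite /= in_itv/= => /andP[x0 xt]; split => //.
  by apply: (I_down hI It) => //; exact: ltW.
have mw := lmeas_weight It.
have mfw : lmeas `]0, t]%classic (fun x => f x * w x).
  by apply: measurable_funM => //; apply: lmeas_of_borel => //; exact: measurable_itv.
have It2 : I (t / 2) by apply: (I_down hI It); lra.
have t20 : 0 < t / 2 by lra.
have sub2 : `]0, (t / 2)]%classic `<=` `]0, t]%classic.
  by move=> x; rewrite /= !in_itv/= => /andP[-> xt]/=; lra.
have dy2 k : dyadic (t / 2) k = dyadic t k.+1.
  have e n : t / 2 / 2 ^+ n = t / 2 ^+ n.+1 by rewrite -mulrA -invfM -exprS.
  by rewrite /dyadic !e.
(* Halving the domain shifts the Lebesgue blocks by one, so that blocks of equal index in the two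
   series are neighbours. *)
apply: (@le_trans _ _ (2%:E * \int[@leb R]_(x in (`]0%R, (t / 2)%R]%classic : set (LebR R)))
    (f x * w x)%:E)%E); last first.
  rewrite lee_pmul2l//; apply: ge0_subset_integral.
  - by apply: lebesgue_of_borel; exact: measurable_itv.
  - by apply: lebesgue_of_borel; exact: measurable_itv.
  - exact/measurable_EFinP.
  - by move=> x /fpos[x0 Ix]; rewrite lee_fin mulr_ge0 ?f0// weight_ge0.
  - exact: sub2.
rewrite -[in leLHS]bigcup_dyadic ge0_integral_bigcup; last first.
- exact: trivIset_dyadic.
- by move=> x [k _] /subset_dyadic/fpos[x0 Ix]; rewrite lee_fin f0.
- by rewrite bigcup_dyadic; exact/measurable_EFinP.
- by move=> k; exact: measurable_dyadic.
rewrite -bigcup_dyadic ge0_integral_bigcup; last first.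
- exact: trivIset_dyadic.
- move=> x [k _] /subset_dyadic/sub2/fpos[x0 Ix].
  by rewrite lee_fin mulr_ge0 ?f0// weight_ge0.
- rewrite bigcup_dyadic; apply/measurable_EFinP; apply: measurable_funS mfw => //.
  by apply: lebesgue_of_borel; exact: measurable_itv.
- by move=> k; apply: lebesgue_of_borel; exact: measurable_dyadic.
(* The [dphi]-mass of a dyadic block is at most twice the [w]-mass of the next
   one towards [0], on which [f] is larger. *)
rewrite -nneseriesZl; last first.
  move=> k _; apply: integral_ge0 => x /subset_dyadic/sub2/fpos[x0 Ix].
  by rewrite lee_fin mulr_ge0 ?f0// weight_ge0.
apply: lee_nneseries => k _.
  move=> _; apply: integral_ge0 => x /subset_dyadic/fpos[x0 Ix].
  by rewrite lee_fin f0.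
have [a0 Ia] := pos_I k It t0; set a := t / 2 ^+ k in a0 Ia.
have a20 : 0 < a / 2 by lra.
have Ia2 : I (a / 2) by apply: (I_down hI Ia); lra.
have e1 : t / 2 ^+ k.+1 = a / 2 by rewrite /a exprS invfM mulrCA mulrC.
have e2 : t / 2 ^+ k.+2 = a / 2 / 2 by rewrite /a !exprS !invfM; lra.
apply: (@le_trans _ _ ((f (a / 2))%:E * dphi X (dyadic t k))%E).
  apply: integral_le_cst.
  - exact: measurable_dyadic.
  - by apply/measurable_EFinP; apply: measurable_funS mf => //; exact: subset_dyadic.
  - move=> x xk; have [x0 Ix] := fpos _ (subset_dyadic xk).
    rewrite !lee_fin f0//= fni//.
    by move: xk; rewrite /dyadic /= in_itv/= e1 => /andP[/ltW].
  - exact: f0.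
(* This block is ]a/4, a/2]: both f and w are at least their values at a/2, and its length a/4 times
   w(a/2) is phi(a/2) - phi(a/4). *)
apply: (@le_trans _ _ (2%:E * ((f (a / 2) * w (a / 2))%:E * leb (dyadic (t / 2) k : set (LebR R))))%E); last first.
  rewrite lee_pmul2l//; apply: integral_ge_cst.
  - by apply: lebesgue_of_borel; exact: measurable_dyadic.
  - apply/measurable_EFinP; apply: measurable_funS mfw => //.
      by apply: lebesgue_of_borel; exact: measurable_itv.
    by move=> x /subset_dyadic/sub2.
  - move=> x xk; have [x0 Ix] := fpos _ (sub2 _ (subset_dyadic xk)).
    have xa : x <= a / 2.
      by move: xk; rewrite dy2 /dyadic /= in_itv/= e1 => /andP[_].
    rewrite lee_fin ler_pM ?f0 ?weight_ge0//; first exact: fni.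
    exact: weight_antitone.
  - by rewrite mulr_ge0 ?f0// weight_ge0.
rewrite leb_dyadic ?(ltW t20)// [dyadic t k]/dyadic e1 -/a dphi_oc_pos//; last lra.
have -> : t / 2 / 2 ^+ k = a / 2 by rewrite /a; lra.
rewrite -!EFinM lee_fin -[f _ * w _ * _]mulrA weightM// mulrCA ler_wpM2l ?f0//.
exact: phi_increment.
Qed.

End WeightedIntegrals.

(** * The spaces Lambda(X) and M*(X) *)

Section Spaces.
Context {R : realType} (I : set R).
Hypothesis hI : I = `[0%R, 1%R]%classic \/ I = `[0%R, +oo[%classic.
Context (X : banach_ri I) (hX : standard_fundamental I X).
Local Notation phi := (fundamental X).
Implicit Types f g h : R -> R.

(* [Phi f t = phi t * Q f^* t], see [QLambda_rearr]. *)
Definition Phi f (t : R) : \bar R := (\int[dphi X]_(x in `[0%R, t]) rearr I f x)%E.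

Lemma Phi_ge0 f t : (0 <= Phi f t)%E.
Proof. by apply: integral_ge0 => x _; exact: rearr_ge0. Qed.

Lemma Lambda_norm_ge0 f : (0 <= Lambda_norm X f)%E.
Proof. by apply: integral_ge0 => x _; exact: rearr_ge0. Qed.

Lemma Mstar_norm_ge f t : I t -> ((phi t)%:E * rearr I f t <= Mstar_norm X f)%E.
Proof. by move=> It; apply: ereal_sup_ubound; exists t. Qed.

Lemma Mstar_norm_ge0 f : (0 <= Mstar_norm X f)%E.
Proof.
by apply: le_trans (Mstar_norm_ge f (I_0 hI)); rewrite (fund0 hX) mul0e.
Qed.

Lemma Mstar_norm_le f c : (0 <= c)%E ->
  (forall t, I t -> 0 < t -> ((phi t)%:E * rearr I f t <= c)%E) ->
  (Mstar_norm X f <= c)%E.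
Proof.
move=> c0 fc; apply: ge_ereal_sup => _ [t It <-].
have [t0|t0] := ltP 0 t; first exact: fc.
by rewrite (phi_le0 hX t0) mul0e.
Qed.

Lemma nonincreasing_pos_measurable f :
  (forall x y, I x -> I y -> 0 < x -> x <= y -> f y <= f x) -> measurable_fun I f.
Proof.
move=> fni.
have [b Ib] : exists b : itv_bound R, I = [set` Interval (BLeft 0) b].
  by case: hI => ->; [exists (BRight 1)|exists +oo%O].
rewrite Ib; apply/measurable_fun_itv_obnd_cbndP.
apply: nonincreasing_on_measurable; first exact: interval_is_interval.
have sub x : [set` Interval (BRight 0) b] x -> I x /\ 0 < x.
  rewrite Ib /= !in_itv/=; case: b {Ib} => [[] b|[]] //= /andP[x0 xb];
    by split => //; rewrite ltW.
by move=> x y /sub[Ix x0] /sub[Iy _]; exact: fni.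
Qed.

(** The majorant c/phi is nonincreasing, so it dominates the rearrangement of h as well as |h|. *)
Lemma Mstar_norm_pointwise h c : (0 <= c) ->
  (forall t, I t -> 0 < t -> phi t * `|h t| <= c) -> (Mstar_norm X h <= c%:E)%E.
Proof.
move=> c0 hc; apply: Mstar_norm_le => // t It t0; have p0 := phi_gt0 hI hX t0.
have mq : measurable_fun I (fun x => c / phi x).
  apply: nonincreasing_pos_measurable => x y _ _ x0 xy.
  have y0 := lt_le_trans x0 xy.
  by rewrite ler_wpM2l// lef_pV2 ?posrE ?phi_gt0// fundamental_nondecreasing.
have ml : lmeas I (fun x => c / phi x) by apply: lmeas_of_borel => //; exact: measurable_I.
have le1 : (rearr I h t <= rearr I (fun x => c / phi x)%R t)%E.
  apply: (rearr_ae_le hI) => //; apply: (aeI_pos hI) => x Ix x0.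
  rewrite [leRHS]ger0_norm; last by rewrite divr_ge0// ltW// phi_gt0.
  by rewrite ler_pdivlMr ?phi_gt0// mulrC hc.
have le2 : (rearr I (fun x => c / phi x)%R t <= (c / phi t)%R%:E)%E.
  apply: (nonincreasing_rearr_le hI) => //.
    by move=> x _ x0; rewrite divr_ge0// ltW// phi_gt0.
  move=> x y _ _ x0 xy; have y0 := lt_le_trans x0 xy.
  by rewrite ler_wpM2l// lef_pV2 ?posrE ?phi_gt0// fundamental_nondecreasing.
apply: (@le_trans _ _ ((phi t)%:E * (c / phi t)%R%:E)%E).
  by rewrite lee_pmul2l//; exact: le_trans le2.
by rewrite -EFinM mulrC divfK// gt_eqF.
Qed.

Lemma measurable_rearr_itv f (i : interval R) : measurable_fun [set` i] (rearr I f).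
Proof. by apply: measurable_rearr; exact: interval_is_interval. Qed.

Lemma measurable_rearr_I f : measurable_fun I (rearr I f).
Proof. by apply: measurable_rearr; exact: is_interval_I. Qed.

Lemma Phi_le_Lambda f t : I t -> (Phi f t <= Lambda_norm X f)%E.
Proof.
move=> It; apply: ge0_subset_integral.
- exact: measurable_itv.
- exact: measurable_I.
- exact: measurable_rearr_I.
- by move=> x _; exact: rearr_ge0.
- exact: (subset_itv_I hI (b := true)).
Qed.

Lemma rearr_le_Phi f t : 0 < t -> ((phi t)%:E * rearr I f t <= Phi f t)%E.
Proof.
move=> t0; rewrite -dphi_cc// muleC -integral_cst; last exact: measurable_itv.
apply: ge0_le_integral.
- exact: measurable_itv.
- by move=> x _; exact: rearr_ge0.
- exact: measurable_cst.
- exact: measurable_rearr_itv.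
- by move=> x; rewrite /= in_itv/= => /andP[_]; exact: le_rearr.
Qed.

Lemma Phi_le_affine f g b t : 0 < t -> 0 <= b ->
  (forall x, 0 <= x -> (rearr I f x <= rearr I g x + b%:E)%E) ->
  (Phi f t <= Phi g t + (b * phi t)%:E)%E.
Proof.
move=> t0 b0 fg; rewrite EFinM -dphi_cc// -integral_cst; last exact: measurable_itv.
rewrite -ge0_integralD; [|exact: measurable_itv|by move=> x _; exact: rearr_ge0
  |exact: measurable_rearr_itv|by move=> x _; rewrite lee_fin|exact: measurable_cst].
apply: ge0_le_integral.
- exact: measurable_itv.
- by move=> x _; exact: rearr_ge0.
- exact: measurable_rearr_itv.
- by apply: emeasurable_funD => //; exact: measurable_rearr_itv.
- by move=> x; rewrite /= in_itv/= => /andP[x0 _]; exact: fg.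
Qed.

Lemma Phi_lt_finite f t : 0 < t -> (Phi f t < +oo)%E -> (rearr I f t < +oo)%E.
Proof.
move=> t0 Pf; have p0 := phi_gt0 hI hX t0.
have := le_lt_trans (rearr_le_Phi f t0) Pf.
by case: (rearr I f t) (rearr_ge0 I f t) => [r| |]//= _; rewrite ?ltry// gt0_muley ?lte_fin.
Qed.

Local Notation A0 := (Lambda X).
Local Notation A1 := (Mstar X).
Local Notation Loo := (Linfty I).
Local Notation S0 := (sum_space I A0 Loo).
Local Notation S1 := (sum_space I A1 Loo).

Lemma rearr_decomp (A : @fspace R) f (ab : (R -> R) * (R -> R)) x :
  (forall h, A h -> lmeas I h) -> sum_decomp I A Loo f ab ->
  (rearr I f x <= rearr I ab.1 x + (fnorm Loo ab.2)%:E)%E.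
Proof.
move=> mA [Aa /LinftyP[b0 bn] fE].
rewrite -[X in (X + _)%E]mul1e; apply: (rearr_le_affine hI) => //; first exact: mA.
apply: (aeI_imp2 hI) bn fE => y _ _ bn ->.
by rewrite mul1r (le_trans (ler_normD _ _))// lerD2l.
Qed.

(** On [0, t] a summand bounded by b adds at most b phi(t). *)
Lemma sum_Lambda_finite f : S0 f -> lmeas I f /\
  forall t, I t -> 0 < t -> (Phi f t < +oo)%E.
Proof.
move=> [mf [ab abf]]; split => // t It t0.
have [[_ La] /LinftyP[b0 _] _] := abf.
apply: le_lt_trans (Phi_le_affine t0 b0 _) _.
  by move=> x _; apply: rearr_decomp abf => h [].
by rewrite lte_add_pinfty ?ltry// (le_lt_trans _ La)// Phi_le_Lambda.
Qed.

Lemma sum_Mstar_finite g : S1 g -> lmeas I g /\ rearr_finite I g.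
Proof.
move=> [mg [ab abg]]; split => // t It t0; have p0 := phi_gt0 hI hX t0.
have [[_ Ma] _ _] := abg.
apply: le_lt_trans (rearr_decomp t _ abg) _; first by move=> h [].
rewrite lte_add_pinfty ?ltry//.
have := le_lt_trans (Mstar_norm_ge ab.1 It) Ma.
by case: (rearr I ab.1 t) (rearr_ge0 I ab.1 t) => [r| |]//= _; rewrite ?ltry// gt0_muley ?lte_fin.
Qed.

Lemma enorm_Lambda f : lmeas I f -> enorm A0 f = Lambda_norm X f.
Proof.
move=> mf; rewrite /enorm; case: asboolP => [[_ foo]|nf].
  by rewrite /= fineK// ge0_fin_numE// Lambda_norm_ge0.
by apply/esym/eqP; rewrite -leye_eq leNgt; apply/negP => foo; apply: nf.
Qed.

Lemma enorm_Mstar f : lmeas I f -> enorm A1 f = Mstar_norm X f.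
Proof.
move=> mf; rewrite /enorm; case: asboolP => [[_ foo]|nf].
  by rewrite /= fineK// ge0_fin_numE// Mstar_norm_ge0.
by apply/esym/eqP; rewrite -leye_eq leNgt; apply/negP => foo; apply: nf.
Qed.

Lemma Lambda_norm_cut f t : lmeas I f -> rearr_finite I f -> 0 < t ->
  Lambda_norm X (rearr_cut I f t) =
  (\int[dphi X]_(x in I `&` `]-oo, t[%classic) rearr I f x)%E.
Proof.
move=> mf ff t0; rewrite integral_mkcondr; apply: eq_integral => x xI.
rewrite (rearr_cutE hI) ?(I_ge0 hI)// patchE.
have [xt|tx] := ltP x t; first by rewrite mem_set//= in_itv/=.
by rewrite memNset//= in_itv/=; apply/negP; rewrite -leNgt.
Qed.

Lemma Lambda_norm_cut_ge f s t : lmeas I f -> rearr_finite I f -> I s -> 0 < s ->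
  s < t -> (Phi f s <= Lambda_norm X (rearr_cut I f t))%E.
Proof.
move=> mf ff Is s0 st; rewrite Lambda_norm_cut ?(lt_trans s0)//.
apply: ge0_subset_integral.
- exact: measurable_itv.
- by apply: measurableI; [exact: measurable_I|exact: measurable_itv].
- apply: measurable_funS (measurable_rearr_I f) => //; exact: measurable_I.
- by move=> x _; exact: rearr_ge0.
- move=> x xs; split; first exact: (subset_itv_I hI Is) xs.
  by move: xs; rewrite /= !in_itv/= => /andP[_ xs]; exact: le_lt_trans st.
Qed.

(** The extra piece over ]s, 2s] is at most f^*(s) (phi(2s) - phi(s)) <= f^*(s) phi(s), which is
    again at most [Phi f s]. *)
Lemma Lambda_norm_cut_le f s : lmeas I f -> rearr_finite I f -> 0 < s ->
  (Lambda_norm X (rearr_cut I f (2 * s)) <= 2%:E * Phi f s)%E.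
Proof.
move=> mf ff s0; rewrite Lambda_norm_cut ?mulr_gt0//.
have m1 : measurable (`[0, s]%classic : set R) by exact: measurable_itv.
have m2 : measurable (`]s, 2 * s]%classic : set R) by exact: measurable_itv.
have m12 : measurable_fun (`[0, s]%classic `|` `]s, 2 * s]%classic) (rearr I f).
  have -> : `[0, s]%classic `|` `]s, 2 * s]%classic = `[0, 2 * s]%classic :> set R.
    by rewrite -itv_bndbnd_setU// bnd_simp; lra.
  exact: measurable_rearr_itv.
apply: (@le_trans _ _ (\int[dphi X]_(x in `[0%R, s]%classic `|` `]s, (2 * s)%R]%classic) rearr I f x)%E).
  apply: ge0_subset_integral => //.
  - by apply: measurableI; [exact: measurable_I|exact: measurable_itv].
  - exact: measurableU.
  - by move=> x _; exact: rearr_ge0.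
  - move=> x [/(I_ge0 hI) x0]; rewrite /= !in_itv/= x0/= => xs.
    by case: (leP x s) => sx; [left|right; exact: ltW].
rewrite ge0_integral_setU//; last 2 first.
- by move=> x _; exact: rearr_ge0.
- apply/disj_setPS => x; rewrite /= !in_itv/= => -[/andP[_ xs] /andP[+ _]].
  by rewrite ltNge xs.
have -> : (2%:E * Phi f s = Phi f s + Phi f s)%E.
  by rewrite -[2%:E]/(1%:E + 1%:E)%E ge0_muleDl// mul1e.
apply: leeD => //; apply: le_trans (rearr_le_Phi f s0).
apply: (@le_trans _ _ (\int[dphi X]_(x in `]s, (2 * s)%R]%classic) cst (rearr I f s) x)%E).
  apply: ge0_le_integral => //.
  - by move=> x _; exact: rearr_ge0.
  - exact: measurable_rearr_itv.
  - by move=> x; rewrite /= in_itv/= => /andP[/ltW sx _]; exact: le_rearr.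
rewrite integral_cst// muleC lee_wpmul2r ?rearr_ge0//.
have s2s : s <= 2 * s by lra.
rewrite [leLHS](_ : _ = (phi (2 * s) - phi s)%:E); last exact: dphi_oc_pos.
by rewrite lee_fin; have := phi_double hI hX s; lra.
Qed.

Lemma Mstar_norm_cut_ge g s t : lmeas I g -> rearr_finite I g -> I s -> 0 < s -> s < t ->
  ((phi s)%:E * rearr I g s <= Mstar_norm X (rearr_cut I g t))%E.
Proof.
move=> mg fg Is s0 st; apply: le_trans (Mstar_norm_ge _ Is).
by rewrite (rearr_cutE hI) ?(I_ge0 hI)// ?st// (lt_trans s0).
Qed.

Lemma Mstar_norm_cut_le g t c : lmeas I g -> rearr_finite I g -> 0 < t -> (0 <= c)%E ->
  (forall s, I s -> 0 < s -> s < t -> ((phi s)%:E * rearr I g s <= c)%E) ->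
  (Mstar_norm X (rearr_cut I g t) <= c)%E.
Proof.
move=> mg fg t0 c0 gc; apply: Mstar_norm_le => // s Is s0.
rewrite (rearr_cutE hI)//; case: ifP => st; first exact: gc.
by rewrite mule0.
Qed.

Lemma rearr_scale f c t : 0 < c -> lmeas I f ->
  rearr I (c \*o f) t = (c%:E * rearr I f t)%E.
Proof.
move=> c0 mf; have mcf : lmeas I (c \*o f) by apply: measurable_funM.
apply/eqP; rewrite eq_le; apply/andP; split.
  rewrite -[leRHS]adde0; apply: (rearr_le_affine hI) => //; apply: aeW => x _ /=.
  by rewrite normrM addr0 (ger0_norm (ltW c0)).
have ci0 : 0 < c^-1 by rewrite invr_gt0.
have : (rearr I f t <= c^-1%:E * rearr I (c \*o f) t + 0%:E)%E.
  apply: (rearr_le_affine hI) => //; apply: aeW => x _ /=.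
  by rewrite normrM addr0 (ger0_norm (ltW c0)) mulKf// gt_eqF.
rewrite adde0 => H; have : (c%:E * rearr I f t <= c%:E * (c^-1%:E * rearr I (c \*o f) t))%E.
  by rewrite lee_pmul2l.
by rewrite muleA -EFinM mulfV ?gt_eqF// mul1e.
Qed.

Lemma Phi_scale f c t : 0 < c -> lmeas I f -> Phi (c \*o f) t = (c%:E * Phi f t)%E.
Proof.
move=> c0 mf; rewrite -ge0_integralZl_EFin; [|exact: measurable_itv|by move=> x _; exact: rearr_ge0
  |exact: measurable_rearr_itv|exact: ltW].
by apply: eq_integral => x _; exact: rearr_scale.
Qed.

End Spaces.

(** * Sufficiency *)

Section Majorants.
Context {R : realType} (I : set R).
Hypothesis hI : I = `[0%R, 1%R]%classic \/ I = `[0%R, +oo[%classic.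
Context (X : banach_ri I) (hX : standard_fundamental I X).
Local Notation phi := (fundamental X).
Local Notation A0 := (Lambda X).
Local Notation A1 := (Mstar X).
Local Notation Loo := (Linfty I).
Local Notation S0 := (sum_space I A0 Loo).
Local Notation S1 := (sum_space I A1 Loo).
Implicit Types f g h u : R -> R.

Lemma Lambda_norm0 : Lambda_norm X (cst 0) = 0%E.
Proof.
apply: integral0_eq => x Ix; apply/eqP; rewrite eq_le rearr_ge0 andbT.
by apply: rearr_bounded => //; [exact: I_ge0 Ix|apply: aeW => y _; rewrite normr0].
Qed.

Lemma Lambda0 : A0 (cst 0).
Proof. by split; [exact: measurable_cst|rewrite Lambda_norm0]. Qed.

Lemma Linfty0 : Loo (cst 0).
Proof.
have [] // := @Linfty_bounded _ I (cst 0) 0; first exact: measurable_cst.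
by apply: aeW => x _; rewrite normr0.
Qed.

Lemma sum_of_Lambda f : A0 f -> S0 f.
Proof.
move=> Af; split; first by case: Af.
exists (f, cst 0); split => //=; first exact: Linfty0.
by apply: aeW => x _; rewrite addr0.
Qed.

Lemma sum_of_Linfty f : Loo f -> S0 f.
Proof.
move=> Lf; split; first by case: Lf.
exists (cst 0, f); split => //=; first exact: Lambda0.
by apply: aeW => x _; rewrite add0r.
Qed.

Lemma Mstar_norm_le_Lambda h u (C : R) : A0 h -> A1 u ->
  fnorm A1 u <= C * fnorm A0 h ->
  (Mstar_norm X u <= `|C|%:E * Lambda_norm X h)%E.
Proof.
move=> [_ Lh] [_ Mu] H.
have eu := fineK (eqbRL (ge0_fin_numE (Mstar_norm_ge0 hI hX u)) Mu).
have eh := fineK (eqbRL (ge0_fin_numE (Lambda_norm_ge0 X h)) Lh).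
rewrite -eu -eh -EFinM lee_fin; apply: le_trans H _.
apply: ler_wpM2r; last exact: ler_norm.
exact: fine_ge0 (Lambda_norm_ge0 X h).
Qed.

(** Clipping f to [-l, l] with l = f^*(t) leaves an excess that lives on |f| > l, a set of measure
    at most t. Its rearrangement vanishes from t on and is at most f^* before, so its norm in
    [Lambda X] sees only [0, t]. *)
Lemma truncation f t : lmeas I f -> I t -> 0 < t -> (Phi X f t < +oo)%E ->
  exists f2, [/\ A0 (f \- f2)%R, Loo f2, (Lambda_norm X (f \- f2)%R <= Phi X f t)%E
    & fnorm Loo f2 <= rearrR I f t].
Proof.
move=> mf It t0 Pf; set l := rearrR I f t; have l0 : 0 <= l by exact: rearrR_ge0.
have lE : (l%:E = rearr I f t)%E by rewrite rearrRE// (Phi_lt_finite hI hX t0).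
pose f2 x := Num.max (- l) (Num.min (f x) l).
have mf2 : lmeas I f2.
  by apply: measurable_maxr; [exact: measurable_cst|apply: measurable_minr].
have mf1 : lmeas I (f \- f2)%R by exact: measurable_funB.
have f2l x : `|f2 x| <= l.
  by rewrite /f2 ler_norml le_max lexx/= ge_max ge_min lexx orbT andbT; lra.
have f1f x : `|(f \- f2)%R x| <= `|f x|.
  have nf : `|f x| = f x /\ 0 <= f x \/ `|f x| = - f x /\ f x <= 0.
    case: (leP 0 (f x)) => f0; first by left; split; first exact: ger0_norm.
    by right; split; [exact: ltr0_norm|exact: ltW].
  rewrite /= /f2 ler_norml; case: (leP (f x) l) => fl;
    [case: (leP (- l) (f x)) => lf|case: (leP (- l) l) => lf];
    by apply/andP; split; case: nf => -[-> ?]; lra.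
have f10 x : `|f x| <= l -> (f \- f2)%R x = 0.
  rewrite ler_norml => /andP[lf fl].
  by rewrite /= /f2 (min_idPl fl) (max_idPr lf) subrr.
have r1 x : (rearr I (f \- f2)%R x <= rearr I f x)%E.
  by apply: (rearr_ae_le hI) => //; exact: aeW.
have r10 x : t <= x -> rearr I (f \- f2)%R x = 0%E.
  move=> tx; apply/eqP; rewrite eq_le rearr_ge0 andbT; apply/(rearr_leP hI) => //.
  apply: (@le_trans _ _ t%:E); last by rewrite lee_fin.
  apply: (@le_trans _ _ (distr I f l)); last by apply/(rearr_leP hI) => //; rewrite lE.
  apply: distr_ae_le; apply: aeW => y _ /=.
  by rewrite !ltNge; apply: contra => /f10 /= ->; rewrite normr0.
have L1 : (Lambda_norm X (f \- f2)%R <= Phi X f t)%E.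
  have -> : Lambda_norm X (f \- f2)%R =
      (\int[dphi X]_(x in I) ((rearr I (f \- f2)%R) \_ `[0%R, t]%classic) x)%E.
    apply: eq_integral => x xI; rewrite patchE; case: ifPn => // /negP xt.
    apply: r10; rewrite leNgt; apply/negP => tx; apply: xt.
    by rewrite inE /= in_itv/= (ltW tx) (I_ge0 hI (set_mem xI)).
  rewrite -integral_mkcondr setIC.
  have /setIidPl -> : `[0, t]%classic `<=` I by exact: (subset_itv_I hI (b := true)).
  apply: ge0_le_integral.
  - exact: measurable_itv.
  - by move=> x _; exact: rearr_ge0.
  - exact: measurable_rearr_itv.
  - exact: measurable_rearr_itv.
  - by move=> x _; exact: r1.
have [Lf2 nf2] : Loo f2 /\ fnorm Loo f2 <= l by apply: Linfty_bounded => //; exact: aeW.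
exists f2; split; [split; [exact: mf1|exact: le_lt_trans L1 Pf]|exact: Lf2|exact: L1|exact: nf2].
Qed.

Context (Y Z : @fspace R) (cYZ : couple I A0 A1 Y Z).

(** The class M with the cuts replaced by Q f^*, and with a free factor c that takes in operator
    norms. The estimate is linear in c, so that C depends on the couple alone. *)
Definition majorized : Prop := exists2 C : R, 0 <= C & forall c f g, 0 < c ->
  Y f -> S1 g ->
  (forall t, I t -> 0 < t -> ((phi t)%:E * rearr I g t <= c%:E * Phi X f t)%E) ->
  Z g /\ fnorm Z g <= C * c * fnorm Y f.

Lemma Y_sum f : Y f -> S0 f.
Proof. by case: cYZ => _ _ [_ [H _]] _; exact: H. Qed.

Lemma Y_Phi f : Y f ->
  [/\ lmeas I f, forall t, I t -> 0 < t -> (Phi X f t < +oo)%E & rearr_finite I f].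
Proof.
move=> /Y_sum/(sum_Lambda_finite hI hX)[mf Pf]; split => // t It t0.
by apply: (Phi_lt_finite hI hX t0); exact: Pf.
Qed.

(** Scaling f by c absorbs the factor. The norm of the cut of g at t is governed by the points s <
    t, and for these [Phi] of the scaled function at s is below the norm of its cut at t. *)
Lemma class_M_majorized : class_M I A0 A1 (Y, Z) -> majorized.
Proof.
move=> [_ /= [C C1 H]]; exists C; first exact: le_trans C1.
move=> c f g c0 Yf Sg fg.
have [[K K1 Yqn] _ _] : quasi_banach_ri I Y by case: cYZ.
have [mf Pf ff] := Y_Phi Yf; have [mg fg'] := sum_Mstar_finite hI hX Sg.
have Ycf := qn_scale Yqn c Yf.
have [mcf _ fcf] := Y_Phi Ycf.
have [Zg ng] : Z g /\ fnorm Z g <= C * fnorm Y (c \*o f).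
  apply: H => // t t0; rewrite enorm_Lambda ?(enorm_Mstar hI hX)//; [|exact: lmeas_rearr_cut..].
  apply: (Mstar_norm_cut_le hI hX) => //; first exact: Lambda_norm_ge0.
  move=> s Is s0 st; apply: le_trans (fg s Is s0) _.
  by have := Lambda_norm_cut_ge hI X mcf fcf Is s0 st; rewrite (Phi_scale hI X s c0 mf).
by split => //; move: ng; rewrite (qn_norm_scale Yqn)// ger0_norm ?mulrA// ltW.
Qed.

(** Common to quasilinear and Lipschitz operators: h plays the image of f, and the splitting into u
    and b may change with t while C does not. *)
Lemma majorized_operator : majorized -> forall k c1 c2, 0 < k -> 0 <= c1 -> 0 <= c2 ->
  exists C, forall f h, Y f -> S1 h ->
  (forall t, I t -> 0 < t -> exists u b, [/\ lmeas I u,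
     (Mstar_norm X u <= c1%:E * Phi X f t)%E, 0 <= b, b <= c2 * rearrR I f t
     & aeI I (fun x => `|h x| <= k * `|u x| + b)]) ->
  Z h /\ fnorm Z h <= C * fnorm Y f.
Proof.
(* The summand 1 only keeps the factor positive, as [majorized] requires. *)
move=> [C C0 H] k c1 c2 k0 c10 c20; exists (C * (k * c1 + c2 + 1)) => f h Yf Sh fh.
have kc0 : 0 <= k * c1 + c2 by rewrite addr_ge0// mulr_ge0// ltW.
apply: H => //; first by rewrite ltr_wpDl.
move=> t It t0; have [u [b [mu Mu b0 bc hub]]] := fh t It t0.
have [mf Pf ff] := Y_Phi Yf; have p0 := phi_gt0 hI hX t0.
have P := fineK (eqbRL (ge0_fin_numE (Phi_ge0 X f t)) (Pf t It t0)).
apply: (@le_trans _ _ ((phi t)%:E * (k%:E * rearr I u t + b%:E))%E).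
  by rewrite lee_pmul2l//; exact: (rearr_le_affine hI).
rewrite ge0_muleDr ?lee_fin//; last by rewrite mule_ge0 ?rearr_ge0// lee_fin ltW.
apply: (@le_trans _ _ ((k * c1)%:E * Phi X f t + c2%:E * Phi X f t)%E).
  apply: leeD.
    rewrite muleCA EFinM -muleA lee_pmul2l//.
    exact: le_trans (Mstar_norm_ge X u It) Mu.
  apply: (@le_trans _ _ (c2%:E * ((phi t)%:E * rearr I f t))%E).
    rewrite -(rearrRE (ff t It t0)) -!EFinM lee_fin mulrCA.
    by rewrite ler_wpM2l// ltW.
  by rewrite lee_wpmul2l ?lee_fin// (rearr_le_Phi hI hX).
rewrite -P -!EFinM -EFinD lee_fin.
have := fine_ge0 (Phi_ge0 X f t); rewrite !mulrDl; lra.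
Qed.

Lemma majorized_QLI : majorized -> class_QLI I A0 A1 (Y, Z).
Proof.
move=> dom; split => //= T [TS Tae] [_ [K K1 TK]] [C1 TA] [C2 TL].
have k0 : 0 < K by exact: lt_le_trans K1.
have [C HC] := majorized_operator dom k0 (normr_ge0 C1) (mulr_ge0 (ltW k0) (normr_ge0 C2)).
exists C => f Yf; apply: HC => //; first exact/TS/Y_sum.
move=> t It t0; have [mf Pf ff] := Y_Phi Yf.
have [f2 [Af1 Lf2 Lf1 nf2]] := truncation mf It t0 (Pf t It t0).
have [[mT1 MT1] nT1] := TA _ Af1; have [LT2 nT2] := TL _ Lf2.
have [nT2_0 T2b] := LinftyP LT2.
have [nf2_0 _] := LinftyP Lf2.
exists (T (f \- f2)%R), (K * fnorm Loo (T f2)); split => //.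
- apply: (@le_trans _ _ (`|C1|%:E * Lambda_norm X (f \- f2)%R)%E); last first.
    by rewrite lee_wpmul2l ?lee_fin.
  by apply: Mstar_norm_le_Lambda nT1 => //; split.
- by rewrite mulr_ge0// ltW.
- rewrite -mulrA ler_wpM2l ?(ltW k0)//; apply: le_trans nT2 _.
  apply: (@le_trans _ _ (`|C2| * fnorm Loo f2)).
    exact: (ler_wpM2r nf2_0 (ler_norm C2)).
  exact: (ler_wpM2l (normr_ge0 C2) nf2).
- have fE : f = (f \- f2)%R \+ f2 by apply/funext => x /=; rewrite subrK.
  have := TK _ _ (sum_of_Lambda Af1) (sum_of_Linfty Lf2); rewrite -fE.
  apply: (aeI_imp2 hI) T2b => x _ _ T2x Tx; apply: le_trans Tx _.
  by rewrite mulrDr lerD2l ler_wpM2l// ltW.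
Qed.

Lemma QLI_LI : class_QLI I A0 A1 (Y, Z) -> class_LI I A0 A1 (Y, Z).
Proof.
move=> [_ H]; split => // T TS [Tscale Tadd]; apply: H => //; split.
  by move=> c f Sf; apply: (aeI_imp hI) (Tscale c f Sf) => x _ _ ->; rewrite normrM.
exists 1 => // f g Sf Sg; apply: (aeI_imp hI) (Tadd f g Sf Sg) => x _ _ ->.
by rewrite mul1r ler_normD.
Qed.

(** On [0, 1] the norm is [Phi] at 1. Lipschitz conditions compare two elements of [Lambda X], so
    both f and its truncation must lie there. *)
Lemma Lambda_of_sum f : I = `[0%R, 1%R]%classic -> S0 f -> A0 f.
Proof.
move=> E /(sum_Lambda_finite hI hX)[mf Pf]; split => //.
by have := Pf 1; rewrite /Phi /Lambda_norm -E; apply => //; rewrite E /= in_itv/= lexx ler01.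
Qed.

Lemma majorized_LPI : I = `[0%R, 1%R]%classic -> majorized -> class_LPI I A0 A1 (Y, Z).
Proof.
move=> I1 dom; split => //= T [TS Tae] [T0 TA [C1 TA1]] [_ TL [C2 TL2]] f Yf.
have [C HC] := majorized_operator dom ltr01 (normr_ge0 C1) (normr_ge0 C2).
have Sf := Y_sum Yf; have Af := Lambda_of_sum I1 Sf.
have [] // : Z (T f) /\ fnorm Z (T f) <= C * fnorm Y f.
apply: HC => //; first exact: TS.
move=> t It t0; have [mf Pf ff] := Y_Phi Yf.
have [f2 [Af1 Lf2 Lf1 nf2]] := truncation mf It t0 (Pf t It t0).
have Af2 := Lambda_of_sum I1 (sum_of_Linfty Lf2).
have [mTf MTf] := TA _ Af; have [mTf2 _] := TA _ Af2.
have [nT2_0 T2b] := LinftyP (TL _ Lf2).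
have mu : lmeas I (T f \- T f2)%R by exact: measurable_funB.
(* The Lipschitz estimate bounds only [fine] of this norm, which is 0 at +oo. Finiteness comes from
   T f2 being bounded and phi being at most phi(1) on I. *)
have Mu : (Mstar_norm X (T f \- T f2)%R < +oo)%E.
  apply: (@le_lt_trans _ _ (Mstar_norm X (T f) + (phi 1 * fnorm Loo (T f2))%:E)%E); last first.
    by rewrite lte_add_pinfty ?ltry.
  apply: (Mstar_norm_le hX).
    by rewrite adde_ge0 ?(Mstar_norm_ge0 hI hX)// lee_fin mulr_ge0// phi_ge0.
  move=> s Is s0; have ps := phi_gt0 hI hX s0.
  apply: (@le_trans _ _ ((phi s)%:E * (1%:E * rearr I (T f) s + (fnorm Loo (T f2))%:E))%E).
    rewrite lee_pmul2l//; apply: (rearr_le_affine hI) => //.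
    apply: (aeI_imp hI) T2b => x _ _ T2x /=.
    by rewrite mul1r (le_trans (ler_normB _ _))// lerD2l.
  rewrite mul1e ge0_muleDr ?rearr_ge0 ?lee_fin//; apply: leeD; first exact: Mstar_norm_ge.
  rewrite -EFinM lee_fin ler_wpM2r//; apply: fundamental_nondecreasing.
  by move: Is; rewrite I1 /= in_itv/= => /andP[].
exists (T f \- T f2)%R, (`|C2| * fnorm Loo f2); have [nf2_0 _] := LinftyP Lf2; split => //.
- apply: (@le_trans _ _ (`|C1|%:E * Lambda_norm X (f \- f2)%R)%E); last first.
    by rewrite lee_wpmul2l ?lee_fin.
  by apply: Mstar_norm_le_Lambda (TA1 _ _ Af Af2) => //; split.
- by rewrite mulr_ge0.
- by rewrite ler_wpM2l.
(* T 0 vanishes only almost everywhere, so the estimate speaks of T f2 - T 0, whose membership in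
   L^oo is checked before its norm is used. *)
- have := TL2 _ _ Lf2 Linfty0.
  have -> : f2 \- cst 0 = f2 by apply/funext => x /=; rewrite subr0.
  move=> nT; have [mT0 _] := TL _ Linfty0.
  have mT20 : lmeas I (T f2 \- T (cst 0)) by exact: measurable_funB.
  have [|LT20 _] := @Linfty_bounded _ I (T f2 \- T (cst 0)) _ mT20 nT2_0.
    by apply: (aeI_imp2 hI) T0 T2b => x _ _ /= ->; rewrite subr0.
  have [_ b20] := LinftyP LT20.
  apply: (aeI_imp2 hI) T0 b20 => x _ _ /= ->; rewrite subr0 mul1r => T2x.
  rewrite -[X in `|X| <= _](subrK (T f2 x)) (le_trans (ler_normD _ _))// lerD2l.
  apply: le_trans T2x (le_trans nT _).
  exact: (ler_wpM2r nf2_0 (ler_norm C2)).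
Qed.

End Majorants.

(** * The operator Q *)

Section QLambdaBounded.
Context {R : realType} (I : set R).
Hypothesis hI : I = `[0%R, 1%R]%classic \/ I = `[0%R, +oo[%classic.
Context (X : banach_ri I) (hX : standard_fundamental I X).
Local Notation phi := (fundamental X).
Local Notation A0 := (Lambda X).
Local Notation A1 := (Mstar X).
Implicit Types f g h u : R -> R.

Lemma I_le1 x : 0 <= x -> x <= 1 -> I x.
Proof. by case: hI => -> x0 x1; rewrite /= in_itv/= x0. Qed.

Lemma at0_right0 f : nonneg_nonincreasing I f ->
  at0_right f 0 = ereal_sup [set (f y)%:E | y in `]0, 1[%classic].
Proof.
move=> [f0 fni]; rewrite /at0_right eqxx; apply/cvg_lim => //.
apply: (@nonincreasing_at_right_cvge _ (fun y => (f y)%:E) 0 (BLeft 1)).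
  by rewrite bnd_simp.
move=> x y; rewrite !in_itv/= => /andP[x0 x1] /andP[y0 y1] xy.
by rewrite lee_fin fni//; apply: I_le1; exact: ltW.
Qed.

Lemma at0_right_pos f x : 0 < x -> at0_right f x = (f x)%:E.
Proof. by move=> x0; rewrite /at0_right gt_eqF. Qed.

Lemma at0_right_nonincreasing f x y : nonneg_nonincreasing I f ->
  I y -> 0 <= x -> x <= y -> (at0_right f y <= at0_right f x)%E.
Proof.
move=> nf Iy; have [f0 fni] := nf.
rewrite le_eqVlt => /predU1P[<-|x0] xy; last first.
  rewrite !at0_right_pos ?(lt_le_trans x0)// lee_fin fni//.
  by apply: (I_down hI Iy) => //; exact: ltW.
move: xy; rewrite le_eqVlt => /predU1P[<-//|y0].
rewrite at0_right0// at0_right_pos//.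
have m0 : 0 < Num.min y 2^-1 by rewrite lt_min y0 invr_gt0 ltr0n.
apply: (@le_trans _ _ (f (Num.min y 2^-1))%:E).
  rewrite lee_fin fni ?ge_min ?lexx//; apply: (I_down hI Iy); first exact: ltW.
  by rewrite ge_min lexx.
have m1 : Num.min y 2^-1 < 1.
  by rewrite gt_min; apply/orP; right; rewrite invf_lt1 ?ltr0n ?ltr1n.
apply: ereal_sup_ubound; exists (Num.min y 2^-1) => //.
by rewrite /= in_itv/= m0 m1.
Qed.

Lemma at0_right_ge0 f x : nonneg_nonincreasing I f -> I x -> (0 <= at0_right f x)%E.
Proof.
move=> nf Ix; have [f0 _] := nf.
have [x0|x0] := ltP 0 x; first by rewrite at0_right_pos// lee_fin f0.
have -> : x = 0 by apply/eqP; rewrite eq_le x0 (I_ge0 hI Ix).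
have h2 : 0 < 2^-1 :> R by rewrite invr_gt0 ltr0n.
have I2 : I 2^-1 by apply: I_le1; rewrite ?invf_le1 ?ler1n ?(ltW h2).
apply: le_trans (at0_right_nonincreasing nf I2 (lexx 0) (ltW h2)).
by rewrite at0_right_pos// lee_fin f0.
Qed.

Lemma measurable_at0_right f t : nonneg_nonincreasing I f -> I t ->
  measurable_fun `[0, t]%classic (at0_right f).
Proof.
move=> nf It; apply: nonincreasing_emeasurable; first exact: interval_is_interval.
move=> x y; rewrite /= !in_itv/= => /andP[x0 _] /andP[y0 yt] xy.
by apply: at0_right_nonincreasing => //; exact: (I_down hI It).
Qed.

Lemma rearrR_nonneg_nonincreasing f : rearr_finite I f ->
  nonneg_nonincreasing I (rearrR I f).
Proof.
move=> ff; split => [x _ _|x y Ix _ x0 xy]; first exact: rearrR_ge0.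
by apply: le_rearrR => //; exact: ff.
Qed.

(** At x = 0 this is right continuity with +oo allowed: if f^* <= l near 0+, then |f| > l has
    measure at most e for every e > 0, whence f^*(0) <= l. *)
Lemma at0_right_rearr f x : lmeas I f -> rearr_finite I f -> I x ->
  at0_right (rearrR I f) x = rearr I f x.
Proof.
move=> mf ff Ix; have [x0|x0] := ltP 0 x.
  by rewrite at0_right_pos// rearrRE// ff.
have -> : x = 0 by apply/eqP; rewrite eq_le x0 (I_ge0 hI Ix).
have nf := rearrR_nonneg_nonincreasing ff.
have fE y : `]0, 1[%classic y -> (rearrR I f y)%:E = rearr I f y.
  rewrite /= in_itv/= => /andP[y0 y1]; rewrite rearrRE// ff//.
  by apply: I_le1; exact: ltW.
apply/eqP; rewrite eq_le; apply/andP; split.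
  rewrite at0_right0//; apply: ge_ereal_sup => _ [y y01 <-].
  by rewrite fE//; apply: le_rearr; move: y01; rewrite /= in_itv/= => /andP[/ltW].
have := at0_right_ge0 nf (I_0 hI); case E : (at0_right _ _) => [l| |//]; last by move=> _; rewrite leey.
rewrite lee_fin => l0; apply/(rearr_leP hI) => //; apply/lee_addgt0Pr => e e0.
rewrite add0e; pose y := Num.min e 2^-1.
have y0 : 0 < y by rewrite lt_min e0 invr_gt0 ltr0n.
have y1 : y < 1 by rewrite gt_min; apply/orP; right; rewrite invf_lt1 ?ltr0n ?ltr1n.
have y01 : `]0, 1[%classic y by rewrite /= in_itv/= y0.
apply: (@le_trans _ _ y%:E); last by rewrite lee_fin ge_min lexx.
apply/(rearr_leP hI) => //; rewrite -E at0_right0// -(fE _ y01).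
by apply: ereal_sup_ubound; exists y.
Qed.

Lemma QLambda_rearr f t : lmeas I f -> rearr_finite I f -> I t ->
  QLambda X (rearrR I f) t = ((phi t)^-1%:E * Phi X f t)%E.
Proof.
move=> mf ff It; congr (_ * _)%E; apply: eq_integral => x /set_mem xt.
by rewrite at0_right_rearr//; exact: (subset_itv_I hI It xt).
Qed.

Context (Y Z : @fspace R) (cYZ : couple I A0 A1 Y Z).

Lemma QLambda_class_M : QLambda_bounded X Y Z -> class_M I A0 A1 (Y, Z).
Proof.
move=> [K HK]; split => //=.
exists (Num.max 1 (2 * `|K|)); first by rewrite le_max lexx.
move=> f g Yf Sg fg.
have [[KY KY1 Yqn] _ Yri] : quasi_banach_ri I Y by case: cYZ.
have [[KZ KZ1 Zqn] _ Zri] : quasi_banach_ri I Z by case: cYZ.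
have [mf Pf ff] := Y_Phi hI hX cYZ Yf; have [mg gg] := sum_Mstar_finite hI hX Sg.
have [_ Yfs] := (ri_memE Yri mf).1 Yf.
have [Qfin ZQ nQ] := HK _ Yfs (rearrR_nonneg_nonincreasing ff).
set q := fine \o QLambda X (rearrR I f) in ZQ nQ.
have mq := qn_meas Zqn ZQ.
(* The cuts are taken at 2 s, because the rearrangement of the cut of g at s is 0 at s;
   [Lambda_norm_cut_le] gives the factor 2. *)
have gq s : I s -> 0 < s -> rearrR I g s <= 2 * q s.
  move=> Is s0; have ps := phi_gt0 hI hX s0.
  have s20 : 0 < 2 * s by rewrite mulr_gt0.
  have ss : s < 2 * s by rewrite ltr_pMl// ltr1n.
  have := fg (2 * s) s20.
  rewrite enorm_Lambda ?(enorm_Mstar hI hX)//; [|exact: lmeas_rearr_cut..] => H.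
  have {H} := le_trans (Mstar_norm_cut_ge hI X mg gg Is s0 ss)
    (le_trans H (Lambda_norm_cut_le hI hX mf ff s0)).
  have P := fineK (eqbRL (ge0_fin_numE (Phi_ge0 X f s)) (Pf s Is s0)).
  rewrite -(rearrRE (gg s Is s0)) /q /= QLambda_rearr// -P -!EFinM /= !lee_fin => H.
  by rewrite mulrCA ler_pdivlMl.
have [Zg' ng'] : Z (rearrR I g) /\ fnorm Z (rearrR I g) <= fnorm Z (2 \*o q).
  apply: (ri_ideal Zri); [exact: (qn_scale Zqn 2 ZQ)|exact: lmeas_rearrR|].
  apply: (aeI_pos hI) => s Is s0; rewrite (ger0_norm (rearrR_ge0 I g s)).
  exact: le_trans (gq s Is s0) (ler_norm _).
have Zg : Z g by apply/(ri_memE Zri mg).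
split => //; rewrite (ri_normE Zri Zg); apply: le_trans ng' _.
rewrite (qn_norm_scale Zqn _ ZQ) ger0_norm//.
have nf0 := qn_ge0 Yqn Yf.
have nfE : fnorm Y (rearrR I f) = fnorm Y f by rewrite [RHS](ri_normE Yri Yf).
apply: (@le_trans _ _ (2 * `|K| * fnorm Y f)).
  rewrite -mulrA ler_pM2l//; apply: le_trans nQ _; rewrite nfE.
  exact: (ler_wpM2r nf0 (ler_norm K)).
by apply: (ler_wpM2r nf0); rewrite le_max lexx orbT.
Qed.

End QLambdaBounded.

(** * The weighted average *)

Section WeightedAverage.
Context {R : realType} (I : set R).
Hypothesis hI : I = `[0%R, 1%R]%classic \/ I = `[0%R, +oo[%classic.
Context (X : banach_ri I) (hX : standard_fundamental I X).
Local Notation phi := (fundamental X).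
Local Notation w := (weight X).
Local Notation A0 := (Lambda X).
Local Notation A1 := (Mstar X).
Local Notation Loo := (Linfty I).
Local Notation S0 := (sum_space I A0 Loo).
Local Notation S1 := (sum_space I A1 Loo).
Local Notation oc t := (`]0, t]%classic : set (LebR R)).
Implicit Types f g h u : R -> R.

Definition locally_Lambda f : Prop :=
  lmeas I f /\ forall t, I t -> 0 < t -> (Phi X f t < +oo)%E.

(** Unlike an integral against [dphi] with an atom at 0, this ignores null sets and makes sense for
    signed, non-monotone f. *)
Definition weighted_average f t : R :=
  (phi t)^-1 * (\int[@leb R]_(x in oc t) (f x * w x)).
Local Notation avg := weighted_average.

Lemma oc_I t : I t -> oc t `<=` I.
Proof. by move=> It; exact: (subset_itv_I hI (b := false) It). Qed.

Lemma oc_gt0 t x : oc t x -> 0 < x.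
Proof. by rewrite /= in_itv/= => /andP[]. Qed.

Lemma measurable_oc t : measurable (oc t).
Proof. by apply: lebesgue_of_borel; exact: measurable_itv. Qed.

Lemma measurable_mul_weight f t : lmeas I f -> I t ->
  measurable_fun (oc t) (fun x => f x * w x).
Proof.
move=> mf It; apply: measurable_funM; last exact: lmeas_weight.
apply: measurable_funS mf; last exact: oc_I.
exact: lebesgue_of_borel (measurable_I hI).
Qed.

Lemma locally_Lambda_le f g : locally_Lambda f -> lmeas I g ->
  aeI I (fun x => `|g x| <= `|f x|) -> locally_Lambda g.
Proof.
move=> [mf Pf] mg gf; split; first exact: mg.
move=> t It t0; apply: le_lt_trans (Pf t It t0).
apply: ge0_le_integral.
- exact: measurable_itv.
- by move=> x _; exact: rearr_ge0.
- exact: measurable_rearr_itv.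
- exact: measurable_rearr_itv.
- by move=> x _; exact: (rearr_ae_le hI).
Qed.

Lemma integrable_mul_weight f t : locally_Lambda f -> I t -> 0 < t ->
  (@leb R).-integrable (oc t) (EFin \o (fun x => f x * w x)).
Proof.
move=> [mf Pf] It t0; apply/integrableP; split.
  by apply/measurable_EFinP; exact: measurable_mul_weight.
have -> : (\int[@leb R]_(x in oc t) `|(EFin \o (fun x => f x * w x)%R) x| =
    \int[@leb R]_(x in oc t) (`|f x| * w x)%:E)%E.
  apply: eq_integral => x /set_mem/oc_gt0 x0.
  by rewrite /= normrM (ger0_norm (weight_ge0 X x0)).
apply: le_lt_trans (integral_weight_le_rearr hI hX mf It t0) _.
by rewrite lte_mul_pinfty// Pf.
Qed.

(** Both endpoint bounds follow from this one: [Phi X f t] is at most the norm of f in [Lambda X],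
    and at most phi(t) times its norm in L^oo. *)
Lemma weighted_average_bound f t : locally_Lambda f -> I t -> 0 < t ->
  phi t * `|avg f t| <= 8 * fine (Phi X f t).
Proof.
move=> Af It t0; have p0 := phi_gt0 hI hX t0; have [mf Pf] := Af.
rewrite /avg normrM (ger0_norm _) ?invr_ge0 ?(ltW p0)// mulVKf ?gt_eqF//.
apply: le_trans (le_normr_Rintegral (measurable_oc t) (integrable_mul_weight Af It t0)) _.
have P := fineK (eqbRL (ge0_fin_numE (Phi_ge0 X f t)) (Pf t It t0)).
rewrite -lee_fin EFinM P.
have hl := integral_weight_le_rearr hI hX mf It t0.
have e : (\int[@leb R]_(x in oc t) (`|f x * w x|)%:E =
    \int[@leb R]_(x in oc t) (`|f x| * w x)%:E)%E.
  apply: eq_integral => x /set_mem/oc_gt0 x0.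
  by rewrite normrM (ger0_norm (weight_ge0 X x0)).
rewrite /Rintegral e fineK// ge0_fin_numE.
  by apply: le_lt_trans hl _; rewrite lte_mul_pinfty// Pf.
apply: integral_ge0 => x /oc_gt0 x0.
by rewrite lee_fin mulr_ge0// weight_ge0.
Qed.

Lemma weighted_average_ae_eq f g t : lmeas I f -> lmeas I g ->
  aeI I (fun x => f x = g x) -> I t -> avg f t = avg g t.
Proof.
move=> mf mg fg It; congr (_ * fine _); apply: ae_eq_integral.
- exact: measurable_oc.
- by apply/measurable_EFinP; exact: measurable_mul_weight.
- by apply/measurable_EFinP; exact: measurable_mul_weight.
- move: fg; rewrite /aeI; apply: filterS => x fg xt.
  by rewrite fg//; exact: oc_I xt.
Qed.

Lemma weighted_average_scale c f t : locally_Lambda f -> I t -> 0 < t ->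
  avg (c \*o f) t = c * avg f t.
Proof.
move=> Af It t0; rewrite /avg mulrCA; congr (_ * _).
rewrite -RintegralZl; [|exact: measurable_oc|exact: integrable_mul_weight].
by apply: eq_Rintegral => x _ /=; rewrite mulrA.
Qed.

Lemma weighted_averageD f g t : locally_Lambda f -> locally_Lambda g -> I t -> 0 < t ->
  avg (f \+ g) t = avg f t + avg g t.
Proof.
move=> Af Ag It t0; rewrite /avg -mulrDr; congr (_ * _).
rewrite -RintegralD; [|exact: measurable_oc|exact: integrable_mul_weight..].
by apply: eq_Rintegral => x _ /=; rewrite mulrDl.
Qed.

Lemma weighted_averageB f g t : locally_Lambda f -> locally_Lambda g -> I t -> 0 < t ->
  avg (f \- g) t = avg f t - avg g t.
Proof.
move=> Af Ag It t0; rewrite /avg -mulrBr; congr (_ * _).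
rewrite -RintegralB; [|exact: measurable_oc|exact: integrable_mul_weight..].
by apply: eq_Rintegral => x _ /=; rewrite mulrBl.
Qed.

Lemma weighted_average_ge0 f t : (forall x, 0 < x -> I x -> 0 <= f x) -> I t -> 0 <= avg f t.
Proof.
move=> f0 It; rewrite mulr_ge0 ?invr_ge0 ?phi_ge0//; apply: Rintegral_ge0 => x xt.
by rewrite mulr_ge0 ?weight_ge0 ?f0//; [exact: oc_gt0 xt|exact: oc_I xt|exact: oc_gt0 xt].
Qed.

Lemma weighted_average_ae_le f g t : locally_Lambda f -> lmeas I g ->
  aeI I (fun x => 0 <= g x <= f x) -> I t -> 0 < t -> 0 <= avg g t <= avg f t.
Proof.
move=> Af mg gf It t0; have [mf _] := Af.
have Ag : locally_Lambda g.
  apply: locally_Lambda_le Af mg _; apply: (aeI_imp hI) gf => x _ _ /andP[g0 gf].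
  by rewrite !ger0_norm// (le_trans g0).
have mfg : lmeas I (f \- g) by exact: measurable_funB.
(* Absolute values turn the inequalities valid almost everywhere into inequalities valid everywhere,
   without changing the averages. *)
have mafg : lmeas I (fun x => `|f x - g x|) by apply: measurableT_comp.
have mag : lmeas I (fun x => `|g x|) by apply: measurableT_comp.
have eg : avg g t = avg (fun x => `|g x|) t.
  apply: weighted_average_ae_eq => //; apply: (aeI_imp hI) gf => x _ _ /andP[g0 _].
  by rewrite ger0_norm.
have efg : avg (f \- g) t = avg (fun x => `|f x - g x|) t.
  apply: weighted_average_ae_eq => //; apply: (aeI_imp hI) gf => x _ _ /andP[_ gf].
  by rewrite /= ger0_norm// subr_ge0.
rewrite {1}eg weighted_average_ge0//= -subr_ge0 -weighted_averageB// efg.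
exact: weighted_average_ge0.
Qed.

(** For nonnegative f the integral over ]0, t] is nondecreasing in t, hence measurable; positive and
    negative parts give the general case. *)
Lemma lmeas_weighted_average f : locally_Lambda f -> lmeas I (avg f).
Proof.
move=> Af; have [mf Pf] := Af.
have main g : (forall x, 0 <= g x) -> locally_Lambda g ->
    measurable_fun I (fun t => \int[@leb R]_(x in oc t) (g x * w x)).
  move=> g0 Ag; apply: nondecreasing_on_measurable; first exact: is_interval_I.
  move=> s t Is It st; have [t0|t0] := ltP 0 t; last first.
    have -> : s = t by apply/eqP; rewrite eq_le st (le_trans t0)// (I_ge0 hI).
    by [].
  have [s0|s0] := ltP 0 s; last first.
    rewrite [X in X <= _](_ : _ = 0).
      by apply: Rintegral_ge0 => x /oc_gt0 x0; rewrite mulr_ge0// weight_ge0.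
    by rewrite set_itv_ge ?Rintegral_set0// bnd_simp -leNgt.
  have fin r : I r -> 0 < r -> (\int[@leb R]_(x in oc r) (g x * w x)%:E)%E \is a fin_num.
    move=> Ir r0; have := integrable_mul_weight Ag Ir r0.
    by apply: integrable_fin_num; exact: measurable_oc.
  apply: fine_le; [exact: fin|exact: fin|].
  apply: ge0_subset_integral.
  - exact: measurable_oc.
  - exact: measurable_oc.
  - by apply/measurable_EFinP; apply: measurable_mul_weight => //; case: Ag.
  - by move=> x /oc_gt0 x0; rewrite lee_fin mulr_ge0// weight_ge0.
  - by move=> x; rewrite /= !in_itv/= => /andP[-> xs]/=; exact: le_trans st.
pose fp x := Num.max (f x) 0; pose fm x := Num.max (- f x) 0.
have fE : f = fp \- fm.
  apply/funext => x; rewrite /fp /fm /=.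
  by case: (leP (f x) 0) => fx; case: (leP (- f x) 0) => fx'; lra.
have mfp : lmeas I fp by apply: measurable_maxr; [exact: mf|exact: measurable_cst].
have mfm : lmeas I fm.
  by apply: measurable_maxr; [exact: measurable_funN|exact: measurable_cst].
have fp0 x : 0 <= fp x by rewrite /fp le_max lexx orbT.
have fm0 x : 0 <= fm x by rewrite /fm le_max lexx orbT.
have Afp : locally_Lambda fp.
  apply: locally_Lambda_le Af mfp _; apply: aeW => x _; rewrite ger0_norm// /fp.
  by rewrite ge_max ler_norm normr_ge0.
have Afm : locally_Lambda fm.
  apply: locally_Lambda_le Af mfm _; apply: aeW => x _; rewrite ger0_norm// /fm.
  by rewrite ge_max normr_ge0 -normrN ler_norm.
have mphi : lmeas I (fun t => (phi t)^-1).
  apply: lmeas_of_borel; first exact: measurable_I.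
  apply: (nonincreasing_pos_measurable hI) => x y _ _ x0 xy; have y0 := lt_le_trans x0 xy.
  by rewrite lef_pV2 ?posrE ?(phi_gt0 hI hX)// fundamental_nondecreasing.
have mJ : lmeas I (fun t => \int[@leb R]_(x in oc t) (fp x * w x) -
    \int[@leb R]_(x in oc t) (fm x * w x)).
  apply: lmeas_of_borel; first exact: measurable_I.
  by apply: measurable_funB; exact: main.
apply: eq_measurable_fun (measurable_funM mphi mJ).
move=> t /set_mem It; have [t0|t0] := ltP 0 t; last first.
  by rewrite /avg /= (phi_le0 hX t0) invr0 !mul0r.
rewrite /= mulrBr [in RHS]fE; apply/esym; exact: weighted_averageB.
Qed.

Lemma sum_locally_Lambda f : S0 f -> locally_Lambda f.
Proof. exact: sum_Lambda_finite. Qed.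

Lemma weighted_average_Mstar f : A0 f ->
  (Mstar_norm X (avg f) <= 8%:E * Lambda_norm X f)%E.
Proof.
move=> Af; have [mf Lf] := Af.
have L := fineK (eqbRL (ge0_fin_numE (Lambda_norm_ge0 X f)) Lf).
have lA := sum_locally_Lambda (sum_of_Lambda Af).
rewrite -L -EFinM; apply: (Mstar_norm_pointwise hI hX).
  by rewrite mulr_ge0// fine_ge0// Lambda_norm_ge0.
move=> t It t0; apply: le_trans (weighted_average_bound lA It t0) _.
rewrite ler_pM2l// -lee_fin L fineK; first exact: Phi_le_Lambda.
by rewrite ge0_fin_numE ?Phi_ge0//; case: lA => _; exact.
Qed.

Lemma weighted_average_A1 f : A0 f ->
  A1 (avg f) /\ fnorm A1 (avg f) <= 8 * fnorm A0 f.
Proof.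
move=> Af; have H := weighted_average_Mstar Af; have [mf Lf] := Af.
have lA := sum_locally_Lambda (sum_of_Lambda Af).
have Moo : (Mstar_norm X (avg f) < +oo)%E.
  by apply: le_lt_trans H _; rewrite lte_mul_pinfty.
split; first by split => //; exact: lmeas_weighted_average.
rewrite -lee_fin EFinM /= !fineK//.
- by rewrite ge0_fin_numE// Lambda_norm_ge0.
- by rewrite ge0_fin_numE// Mstar_norm_ge0.
Qed.

Lemma weighted_average_Linfty f : Loo f ->
  Loo (avg f) /\ fnorm Loo (avg f) <= 8 * fnorm Loo f.
Proof.
move=> Lf; have lA := sum_locally_Lambda (sum_of_Linfty hI X Lf).
have [n0 nf] := LinftyP Lf; have [mf Pf] := lA.
apply: Linfty_bounded; [exact: lmeas_weighted_average|by rewrite mulr_ge0|].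
apply: (aeI_pos hI) => t It t0; have p0 := phi_gt0 hI hX t0.
rewrite -(ler_pM2l p0); apply: le_trans (weighted_average_bound lA It t0) _.
rewrite mulrCA ler_pM2l// -lee_fin fineK; last by rewrite ge0_fin_numE ?Phi_ge0// Pf.
rewrite mulrC EFinM -dphi_cc//; apply: integral_le_cst => //.
- exact: measurable_rearr_itv.
- move=> x; rewrite /= in_itv/= => /andP[x0 _].
  by rewrite rearr_ge0/= rearr_bounded.
Qed.

Lemma weighted_average_operator : operator I S0 S1 avg.
Proof.
split=> [f Sf|f g Sf Sg fg]; last first.
  apply: (aeI_pos hI) => t It t0.
  by apply: weighted_average_ae_eq => //; [case: Sf|case: Sg].
split; first exact/lmeas_weighted_average/sum_locally_Lambda.
have [mf [ab [Aa Lb fE]]] := Sf.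
exists (avg ab.1, avg ab.2); split => /=.
- by have [] := weighted_average_A1 Aa.
- by have [] := weighted_average_Linfty Lb.
- apply: (aeI_pos hI) => t It t0.
  have la := sum_locally_Lambda (sum_of_Lambda Aa).
  have lb := sum_locally_Lambda (sum_of_Linfty hI X Lb).
  rewrite -weighted_averageD//; apply: weighted_average_ae_eq => //.
  by apply: measurable_funD; [case: la|case: lb].
Qed.

Lemma weighted_average_linear : linear_op I S0 avg.
Proof.
split=> [c f Sf|f g Sf Sg]; apply: (aeI_pos hI) => t It t0.
  by apply: weighted_average_scale => //; exact: sum_locally_Lambda.
by apply: weighted_averageD => //; exact: sum_locally_Lambda.
Qed.

Context (Y Z : @fspace R) (cYZ : couple I A0 A1 Y Z).

Lemma class_LI_weighted_average : class_LI I A0 A1 (Y, Z) -> forall f, Y f -> Z (avg f).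
Proof.
move=> [_ /= H] f Yf.
have [] := H _ weighted_average_operator weighted_average_linear.
- by exists 8 => g; exact: weighted_average_A1.
- by exists 8 => g; exact: weighted_average_Linfty.
by move=> C /(_ f Yf)[].
Qed.

End WeightedAverage.

(** * Necessity *)

Section Necessity.
Context {R : realType} (I : set R).
Hypothesis hI : I = `[0%R, 1%R]%classic \/ I = `[0%R, +oo[%classic.
Context (X : banach_ri I) (hX : standard_fundamental I X).
Local Notation phi := (fundamental X).
Local Notation A0 := (Lambda X).
Local Notation A1 := (Mstar X).
Local Notation avg := (weighted_average X).
Implicit Types f g h u : R -> R.

(** The shape of the superlevel sets of a rearrangement on [0, t], with a the distribution function
    at the level, possibly +oo. *)
Definition initial (t : R) (a : \bar R) : set R :=
  `[0, t]%classic `&` [set x | (x%:E < a)%E].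

Lemma measurable_initial t a : measurable (initial t a).
Proof.
apply: measurableI; first exact: measurable_itv.
apply: is_interval_measurable => x y /= _ ya z /andP[_ zy].
by apply: le_lt_trans ya; rewrite lee_fin.
Qed.

Lemma initial_superlevel f s t : lmeas I f -> 0 <= s ->
  `[0, t]%classic `&` superlevel (rearr I f) s = initial t (distr I f s).
Proof.
move=> mf s0; apply/seteqP; split => x [xt xs]; split => //;
  exact/(rearr_gtP hI).
Qed.

(** One factor 2 is the doubling of phi, the other is lost on the half-open end. *)
Lemma dphi_initial_double t (a : \bar R) : I t -> 0 < t -> (0 <= a)%E ->
  (dphi X (initial t (a + a)) <= 4%:E * dphi X (initial t a))%E.
Proof.
move=> It t0 a0; have [ta|at_] := leP t%:E a.
  apply: (@le_trans _ _ (dphi X `[0%R, t]%classic)).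
    apply: dphi_le; [exact: measurable_initial|exact: measurable_itv|by move=> x []].
  rewrite dphi_cc//; apply: le_trans (phi_le_dphi_co hI hX t0) _.
  apply: (@le_trans _ _ (2%:E * dphi X (initial t a))%E).
    rewrite lee_pmul2l//; apply: dphi_le; [exact: measurable_itv|exact: measurable_initial|].
    move=> x; rewrite /= in_itv/= => /andP[x0 xt]; split.
      by rewrite /= in_itv/= x0 ltW.
    by apply: lt_le_trans ta; rewrite lte_fin.
  by rewrite lee_wpmul2r// lee_fin; lra.
have af : a \is a fin_num by rewrite ge0_fin_numE// (lt_trans at_)// ltry.
rewrite -(fineK af) in a0 at_ *; set m := fine a in a0 at_ *.
move: a0; rewrite lee_fin le_eqVlt => /predU1P[<-|m0].
  rewrite (_ : initial _ _ = set0) ?measure0 ?mule_ge0//.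
  apply/seteqP; split => // x [/=]; rewrite in_itv/= adde0 lte_fin => /andP[x0 _].
  by rewrite ltNge x0.
rewrite lte_fin in at_.
have m20 : 0 < 2 * m by rewrite mulr_gt0.
apply: (@le_trans _ _ (dphi X `[0, 2 * m]%classic)%R).
  apply: dphi_le; [exact: measurable_initial|exact: measurable_itv|].
  move=> x [/=]; rewrite !in_itv/= -EFinD lte_fin => /andP[-> _] xm /=; lra.
rewrite dphi_cc//; apply: (@le_trans _ _ (2 * phi m)%:E).
  by rewrite lee_fin phi_double.
have -> : 4%:E = (2%:E * 2%:E)%E :> \bar R by rewrite -EFinM; congr (_%:E); lra.
rewrite EFinM -muleA lee_pmul2l//; apply: le_trans (phi_le_dphi_co hI hX m0) _.
rewrite lee_pmul2l//; apply: dphi_le; [exact: measurable_itv|exact: measurable_initial|].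
move=> x; rewrite /= in_itv/= => /andP[x0 xm]; split; last by rewrite /= lte_fin.
by rewrite /= in_itv/= x0/=; lra.
Qed.

Lemma dphi_initialD t (a b : \bar R) : I t -> 0 < t -> (0 <= a)%E -> (0 <= b)%E ->
  (dphi X (initial t (a + b)) <=
   4%:E * (dphi X (initial t a) + dphi X (initial t b)))%E.
Proof.
move=> It t0.
wlog ab : a b / (a <= b)%E => [H|] a0 b0.
  by case/orP: (le_total a b) => ab; [|rewrite addeC [X in (_ * X)%E]addeC]; exact: H.
apply: (@le_trans _ _ (dphi X (initial t (b + b)))).
  apply: dphi_le; [exact: measurable_initial..|].
  by move=> x [xt xab]; split => //; apply: lt_le_trans xab _; rewrite leeD2r.
apply: le_trans (dphi_initial_double It t0 b0) _.
by rewrite lee_pmul2l// leeDr.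
Qed.

Lemma distrB_le f g s : (distr I (f \- g)%R (s + s)%R <= distr I f s + distr I g s)%E.
Proof.
apply: le_trans (outer_measureU2 _ _ _); apply: leb_subset => x [Ix /= xs].
have [fs|fs] := ltP s `|f x|; [by left|right; split => //=].
have := ler_normB (f x) (g x); lra.
Qed.

(** A crude triangle inequality on levels: |f - g| > 2n forces |f| > n or |g| > n, so layers of
    height 2 are compared with layers of height 1. The factor 8 is 2 times the 4 of [dphi_initialD],
    and the added masses of [0, t] are rounding errors; only finiteness is wanted. *)
Lemma locally_LambdaB f g : locally_Lambda X f -> locally_Lambda X g ->
  locally_Lambda X (f \- g).
Proof.
move=> [mf Pf] [mg Pg]; have mfg : lmeas I (f \- g) by exact: measurable_funB.
split; first exact: mfg.
move=> t It t0; have mt : measurable (`[0, t]%classic : set R) by exact: measurable_itv.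
have mr h : measurable_fun `[0, t]%classic (rearr I h) by exact: measurable_rearr_itv.
have r0 h x : `[0, t]%classic x -> (0 <= rearr I h x)%E by move=> _; exact: rearr_ge0.
have H : (Phi X (f \- g)%R t <= 8%:E * ((Phi X f t + 1%:E * dphi X `[0%R, t]%classic) +
    (Phi X g t + 1%:E * dphi X `[0%R, t]%classic)))%E.
  have -> : (Phi X (f \- g)%R t =
      \int[dphi X]_(x in `[0%R, t]) (rearr I (f \- g)%R x * (cst 1%R x)%:E))%E.
    by apply: eq_integral => x _; rewrite mule1.
  apply: le_trans (integral_le_layers (dphi X) (e := 2) mt (mr _) (r0 _) _ _ _) _ => //.
  apply: (@le_trans _ _ (8%:E * (
      \sum_(n <oo) (1%:E * dphi X (`[0%R, t]%classic `&` superlevel (rearr I f) (n%:R * 1)%R)) +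
      \sum_(n <oo) (1%:E * dphi X (`[0%R, t]%classic `&` superlevel (rearr I g) (n%:R * 1)%R)))))%E; last first.
    by rewrite lee_pmul2l//; apply: leeD; apply: layers_le_integral; first [exact: mt|exact: mr|exact: r0|exact: ltr01].
  rewrite -nneseriesD; [|by move=> n _ _; rewrite mule_ge0..].
  rewrite -nneseriesZl; last by move=> n _; rewrite adde_ge0// mule_ge0.
  apply: lee_nneseries => n _.
    by move=> _; rewrite mule_ge0//; apply: integral_ge0 => x _; rewrite lee_fin.
  have n0 : 0 <= n%:R * 1 :> R by rewrite mulr1.
  have n20 : 0 <= n%:R * 2 :> R by rewrite mulr_ge0.
  rewrite !mul1e (initial_superlevel _ mf n0) (initial_superlevel _ mg n0).
  rewrite (initial_superlevel _ mfg n20) (integral_cst (dphi X) _ 1%:E); last exact: measurable_initial.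
  rewrite mul1e (_ : 8%:E = 2%:E * 4%:E)%E; last by rewrite -EFinM; congr (_%:E); lra.
  rewrite -muleA lee_pmul2l//.
  apply: le_trans (dphi_initialD It t0 (distr_ge0 I f _) (distr_ge0 I g _)).
  apply: dphi_le; [exact: measurable_initial..|].
  move=> x [xt xd]; split => //; apply: lt_le_trans xd _.
  apply: le_trans (distrB_le f g _); rewrite le_eqVlt; apply/orP; left; apply/eqP.
  by congr (distr _ _ _); lra.
apply: le_lt_trans H _; rewrite lte_mul_pinfty// !mul1e dphi_cc//.
have Pd h : (Phi X h t < +oo)%E -> (Phi X h t + (phi t)%:E < +oo)%E.
  by move=> Ph; exact: lte_add_pinfty Ph (ltry _).
exact: lte_add_pinfty (Pd f (Pf t It t0)) (Pd g (Pg t It t0)).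
Qed.

Context (Y Z : @fspace R) (cYZ : couple I A0 A1 Y Z).

Lemma class_LPI_weighted_average : I = `[0%R, 1%R]%classic ->
  class_LPI I A0 A1 (Y, Z) -> forall f, Y f -> Z (avg f).
Proof.
move=> I1 [_ /= H]; apply: H; first exact: weighted_average_operator.
  split.
  - apply: (aeI_pos hI) => t It t0.
    rewrite /weighted_average (_ : (\int[_]_(x in _) _) = 0) ?mulr0//.
    rewrite /Rintegral (_ : (\int[_]_(x in _) _)%E = 0%E)//.
    by apply: integral0_eq => x _; rewrite mul0r.
  - by move=> f Af; have [] := weighted_average_A1 hI hX Af.
  exists 8 => f g Af Ag.
  have lf := sum_locally_Lambda hI hX (sum_of_Lambda Af).
  have lg := sum_locally_Lambda hI hX (sum_of_Lambda Ag).
  have [mfg Pfg] := locally_LambdaB lf lg.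
  have Afg : A0 (f \- g).
    split; first exact: mfg.
    have := Pfg 1; rewrite /Phi /Lambda_norm -I1; apply => //.
    by rewrite I1 /= in_itv/= lexx ler01.
  have [[mT MT] nT] := weighted_average_A1 hI hX Afg.
  (* Additivity of the average is available only at 0 < t in I, so the norms are identified through
     equal rearrangements. *)
  suff <- : fnorm A1 (avg (f \- g)) = fnorm A1 (avg f \- avg g) by [].
  rewrite /= /Mstar_norm; congr (fine (ereal_sup _)); apply/seteqP.
  have e t : rearr I (avg (f \- g)) t = rearr I (avg f \- avg g) t.
    have m1 := lmeas_weighted_average hI hX lf; have m2 := lmeas_weighted_average hI hX lg.
    have m3 : lmeas I (avg f \- avg g) := measurable_funB m1 m2.
    apply/eqP; rewrite eq_le; apply/andP; split; apply: (rearr_ae_le hI) => //;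
      by apply: (aeI_pos hI) => s Is s0; rewrite weighted_averageB.
  by split => _ [t It <-]; exists t => //; rewrite e.
split.
- apply: (aeI_pos hI) => t It t0.
  rewrite /weighted_average (_ : (\int[_]_(x in _) _) = 0) ?mulr0//.
  rewrite /Rintegral (_ : (\int[_]_(x in _) _)%E = 0%E)//.
  by apply: integral0_eq => x _; rewrite mul0r.
- by move=> f Lf; have [] := weighted_average_Linfty hI hX Lf.
exists 8 => f g Lf Lg.
have lf := sum_locally_Lambda hI hX (sum_of_Linfty hI X Lf).
have lg := sum_locally_Lambda hI hX (sum_of_Linfty hI X Lg).
have [mf _] := lf; have [mg _] := lg.
have [f0 fb] := LinftyP Lf; have [g0 gb] := LinftyP Lg.
have mfg : lmeas I (f \- g) by exact: measurable_funB.
have [|Lfg _] := Linfty_bounded mfg (addr_ge0 f0 g0).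
  apply: (aeI_imp2 hI) fb gb => x _ _ fx gx /=.
  by rewrite (le_trans (ler_normB _ _))// lerD.
have [LT nT] := weighted_average_Linfty hI hX Lfg.
have [T0 Tb] := LinftyP LT.
have m1 := lmeas_weighted_average hI hX lf; have m2 := lmeas_weighted_average hI hX lg.
have m3 : lmeas I (avg f \- avg g) := measurable_funB m1 m2.
have [|_ n3] := Linfty_bounded m3 T0.
  apply: (aeI_imp hI) Tb => t It t0; rewrite weighted_averageB//.
exact: le_trans n3 nT.
Qed.

End Necessity.

(** * From mapping Y into Z to a norm estimate on nonnegative functions *)

Section GlidingHump.
Context {R : realType} (I : set R).
Hypothesis hI : I = `[0%R, 1%R]%classic \/ I = `[0%R, +oo[%classic.
Context (X : banach_ri I) (hX : standard_fundamental I X).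
Local Notation A0 := (Lambda X).
Local Notation A1 := (Mstar X).
Local Notation avg := (weighted_average X).
Implicit Types f g h u : R -> R.

(** The first summand is split off each time, so the i-th one pays K^(i+1) whatever N is; summands
    of norm (2K)^-i then have bounded partial sums. *)
Lemma quasi_norm_sum (E : @fspace R) (K : R) : quasi_normed I K E -> 0 <= K ->
  E (cst 0) -> forall (N : nat) (g : nat -> R -> R), (forall n, E (g n)) ->
  E (fun x => \sum_(i < N) g i x) /\
  fnorm E (fun x => \sum_(i < N) g i x) <= \sum_(i < N) K ^+ i.+1 * fnorm E (g i).
Proof.
move=> qn K0 E0; elim=> [|N IH] g Eg.
  have -> : (fun x => \sum_(i < 0) g i x) = cst 0 by apply/funext => x; rewrite big_ord0.
  split => //; rewrite big_ord0 le_eqVlt; apply/orP; left; apply/eqP.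
  by apply/(qn_eq0 qn) => //; exact: aeW.
have [ES nS] := IH (fun n => g n.+1) (fun n => Eg n.+1).
have -> : (fun x => \sum_(i < N.+1) g i x) = g 0 \+ (fun x => \sum_(i < N) g i.+1 x).
  by apply/funext => x; rewrite big_ord_recl.
split; first exact: (qn_add qn).
apply: le_trans (qn_triangle qn (Eg 0) ES) _.
rewrite mulrDr big_ord_recl /= expr1 lerD2l.
apply: le_trans (ler_wpM2l K0 nS) _; rewrite mulr_sumr.
by apply: ler_sum => i _; rewrite mulrA -exprS.
Qed.

Lemma sum_half_pow N : \sum_(i < N) (2^-1 : R) ^+ i <= 2.
Proof.
suff -> : \sum_(i < N) (2^-1 : R) ^+ i = 2 - 2 * 2^-1 ^+ N.
  have : 0 <= (2^-1 : R) ^+ N by rewrite exprn_ge0// invr_ge0 ler0n.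
  lra.
elim: N => [|N IH]; first by rewrite big_ord0 expr0 mulr1 subrr.
by rewrite big_ord_recr/= IH exprS; lra.
Qed.

Context (Y Z : @fspace R) (cYZ : couple I A0 A1 Y Z).

Lemma Y_locally_Lambda f : Y f -> locally_Lambda X f.
Proof. by move=> /(Y_sum cYZ); exact: sum_locally_Lambda. Qed.

Lemma weighted_average_bounded : (forall f, Y f -> Z (avg f)) ->
  exists K : R, forall f, Y f -> (forall x, I x -> 0 < x -> 0 <= f x) ->
    fnorm Z (avg f) <= K * fnorm Y f.
Proof.
move=> TYZ; apply: contrapT => nK.
have [[K K1 Yqn] _ Yri] : quasi_banach_ri I Y by case: cYZ.
have [[KZ KZ1 Zqn] _ Zri] : quasi_banach_ri I Z by case: cYZ.
have K0 : 0 < K by exact: lt_le_trans K1.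
have bad (C : R) : exists f, [/\ Y f, (forall x, I x -> 0 < x -> 0 <= f x) &
    C * fnorm Y f < fnorm Z (avg f)].
  apply: contrapT => nC; apply: nK; exists C => f Yf f0.
  by rewrite leNgt; apply/negP => Cf; apply: nC; exists f.
(* The factor (2K)^n pays for the later normalisation of the n-th function to norm (2K)^-n; the
   factor n survives as growth of the images. *)
have [F FP] := choice (fun n : nat => bad (n%:R * (2 * K) ^+ n)).
have K20 n : 0 < (2 * K) ^+ n by rewrite exprn_gt0// mulr_gt0.
have YF n : Y (F n) by have [] := FP n.
have F0 n x : I x -> 0 < x -> 0 <= F n x by have [_ + _] := FP n; exact.
have nF n : n%:R * (2 * K) ^+ n * fnorm Y (F n) < fnorm Z (avg (F n)) by have [] := FP n.
have lF n := Y_locally_Lambda (YF n).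
have mF n : lmeas I (F n) by have [] := lF n.
(* Otherwise [F n] and its average would vanish almost everywhere, against the strict inequality
   [nF]. *)
have nFpos n : 0 < fnorm Y (F n).
  rewrite lt_neqAle (qn_ge0 Yqn (YF n)) andbT; apply/eqP => nF0.
  have := nF n; rewrite -nF0 mulr0 ltNge => /negP; apply.
  rewrite le_eqVlt; apply/orP; left; apply/eqP; apply/(qn_eq0 Zqn); first exact: TYZ.
  apply: (aeI_pos hI) => t It t0.
  have /(qn_eq0 Yqn (YF n)) Fn0 := esym nF0.
  have -> : avg (F n) t = avg (0 \*o F n) t.
    apply: weighted_average_ae_eq => //; first exact: (qn_meas Yqn (qn_scale Yqn 0 (YF n))).
    by apply: (aeI_imp hI) Fn0 => x _ _ -> /=; rewrite mul0r.
  by rewrite weighted_average_scale// mul0r.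
pose a n := (fnorm Y (F n) * (2 * K) ^+ n)^-1.
have a0 n : 0 < a n by rewrite invr_gt0 mulr_gt0.
pose g n := a n \*o F n.
have Yg n : Y (g n) := qn_scale Yqn (a n) (YF n).
have ng n : fnorm Y (g n) = ((2 * K) ^+ n)^-1.
  rewrite (qn_norm_scale Yqn _ (YF n)) (gtr0_norm (a0 n)) /a invfM mulrAC mulVf ?mul1r//.
  by rewrite gt_eqF.
have g0 n x : I x -> 0 < x -> 0 <= g n x.
  by move=> Ix x0; rewrite /g /= mulr_ge0 ?F0// ltW.
have nTg n : n%:R < fnorm Z (avg (g n)).
  have Zg := TYZ _ (Yg n); have ZF := TYZ _ (YF n).
  have H : aeI I (fun t => `|(a n \*o avg (F n)) t| <= `|avg (g n) t|).
    by apply: (aeI_pos hI) => t It t0; rewrite weighted_average_scale.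
  have [_] := ri_ideal Zri Zg (qn_meas Zqn (qn_scale Zqn (a n) ZF)) H.
  rewrite (qn_norm_scale Zqn _ ZF) (gtr0_norm (a0 n)) => /(lt_le_trans _); apply.
  rewrite /a ltr_pdivlMl ?mulr_gt0// mulrC; apply: le_lt_trans (nF n).
  by rewrite [_ * (2 * K) ^+ n]mulrC mulrA.
have Y0 : Y (cst 0).
  have -> : cst 0 = 0 \*o F 0 by apply/funext => x /=; rewrite mul0r.
  exact: (qn_scale Yqn).
pose s N x := \sum_(i < N) g i x.
have sP N := quasi_norm_sum Yqn (ltW K0) Y0 N Yg.
have sbound N : fnorm Y (s N) <= K * 2.
  have [_ /le_trans] := sP N; apply.
  have -> : \sum_(i < N) K ^+ i.+1 * fnorm Y (g i) = K * \sum_(i < N) (2^-1) ^+ i.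
    rewrite mulr_sumr; apply: eq_bigr => i _; rewrite ng exprMn exprVn exprS.
    have q0 : K ^+ i != 0 by rewrite expf_neq0// gt_eqF.
    have p0 : (2 : R) ^+ i != 0 by rewrite expf_neq0.
    by move: (K ^+ i) ((2 : R) ^+ i) q0 p0 => q p q0 p0; field; rewrite p0 q0.
  by rewrite ler_pM2l// sum_half_pow.
(* The partial sums increase because the summands are nonnegative. Their supremum dominates every
   [g n], and monotonicity of the average makes its image larger than every n. *)
have [||f [Yf fE _]] := ri_fatou Yri (fun N => (sP N).1).
- apply: (aeI_pos hI) => x Ix x0 n; apply/andP; split.
    by apply: sumr_ge0 => i _; exact: g0.
  by rewrite big_ord_recr/= lerDl g0.
- by exists (K * 2) => _ [N _ <-]; exact: sbound.
have gf n : aeI I (fun x => 0 <= g n x <= f x).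
  apply: (aeI_imp hI) fE => x Ix x0 fx; rewrite g0//=.
  rewrite -lee_fin fx; apply: (@le_trans _ _ (s n.+1 x)%:E).
    by rewrite lee_fin /s big_ord_recr/= lerDr; apply: sumr_ge0 => i _; exact: g0.
  by apply: ereal_sup_ubound; exists n.+1.
have lf := Y_locally_Lambda Yf; have Zf := TYZ _ Yf.
have big n : n%:R < fnorm Z (avg f).
  apply: lt_le_trans (nTg n) _.
  have H : aeI I (fun t => `|avg (g n) t| <= `|avg f t|).
    apply: (aeI_pos hI) => t It t0.
    have /andP[h0 h1] := weighted_average_ae_le hI hX lf (qn_meas Yqn (Yg n)) (gf n) It t0.
    by rewrite !ger0_norm// (le_trans h0).
  by have [] := ri_ideal Zri Zf (qn_meas Zqn (TYZ _ (Yg n))) H.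
have := big (Num.bound (fnorm Z (avg f))); rewrite ltNge => /negP; apply.
by apply/ltW/archi_boundP/(qn_ge0 Zqn).
Qed.

End GlidingHump.

(** * The atom of [dphi] at 0, and Q recovered from the weighted average *)

Section QLambdaOfAverage.
Context {R : realType} (I : set R).
Hypothesis hI : I = `[0%R, 1%R]%classic \/ I = `[0%R, +oo[%classic.
Context (X : banach_ri I) (hX : standard_fundamental I X).
Local Notation phi := (fundamental X).
Local Notation A0 := (Lambda X).
Local Notation A1 := (Mstar X).
Local Notation Loo := (Linfty I).
Local Notation S0 := (sum_space I A0 Loo).
Local Notation avg := (weighted_average X).
Implicit Types f g h u : R -> R.

(* [jump = phi (0+)]; the constant [D] of [jump_part_le] divides by it and
   is [0] when there is no jump. *)
Definition jump : R := fine (dphi X [set 0]).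

Lemma dphi_set1_le t : 0 < t -> (dphi X [set 0%R] <= (phi t)%:E)%E.
Proof.
move=> t0; rewrite -dphi_cc//; apply: dphi_le; [exact: measurable_set1|exact: measurable_itv|].
by move=> _ ->; rewrite /= in_itv/= lexx ltW.
Qed.

Lemma jumpE : dphi X [set 0%R] = jump%:E.
Proof.
by rewrite fineK// ge0_fin_numE// (le_lt_trans (dphi_set1_le ltr01))// ltry.
Qed.

Lemma jump_ge0 : 0 <= jump.
Proof. exact: fine_ge0. Qed.

Lemma jump_le t : 0 < t -> jump <= phi t.
Proof. by move=> t0; rewrite -lee_fin -jumpE dphi_set1_le. Qed.

Lemma integral_dphi_set1 (h : R -> \bar R) :
  (\int[dphi X]_(x in [set 0%R]) h x = h 0%R * jump%:E)%E.
Proof.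
rewrite -jumpE -integral_cst; last exact: measurable_set1.
by apply: eq_integral => x /set_mem ->.
Qed.

(** For the summand in [Lambda X], the atom alone contributes jump times its essential supremum to
    the norm; a bounded summand costs jump times its bound. Both are covered by 1 + jump. *)
Lemma jump_mul_rearr_le f : S0 f ->
  (jump%:E * rearr I f 0 <= ((1 + jump) * fnorm S0 f)%:E)%E.
Proof.
move=> [mf [ab0 ab0f]]; have j0 := jump_ge0.
have bound ab : sum_decomp I A0 Loo f ab ->
    (jump%:E * rearr I f 0 <= ((1 + jump) * (fnorm A0 ab.1 + fnorm Loo ab.2))%:E)%E.
  move=> abf; have [[ma La] /LinftyP[b0 _] _] := abf.
  have L := fineK (eqbRL (ge0_fin_numE (Lambda_norm_ge0 X ab.1)) La).
  have a0 : 0 <= fnorm A0 ab.1 by exact: fine_ge0 (Lambda_norm_ge0 X ab.1).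
  apply: (@le_trans _ _ (jump%:E * (rearr I ab.1 0 + (fnorm Loo ab.2)%:E))%E).
    rewrite lee_wpmul2l ?lee_fin//; apply: (rearr_decomp hI) abf.
    by move=> h [].
  rewrite ge0_muleDr ?rearr_ge0 ?lee_fin//.
  apply: (@le_trans _ _ ((fnorm A0 ab.1)%:E + (jump * fnorm Loo ab.2)%:E)%E).
    apply: leeD => //; rewrite [leRHS]L muleC -integral_dphi_set1.
    apply: ge0_subset_integral; [exact: measurable_set1|exact: measurable_I| | |].
    - exact: measurable_rearr_I.
    - by move=> x _; exact: rearr_ge0.
    - by move=> _ ->; exact: I_0.
  rewrite -EFinD lee_fin mulrDl mul1r.
  have h1 : 0 <= jump * fnorm A0 ab.1 by rewrite mulr_ge0.
  by rewrite mulrDr; lra.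
have c0 : 0 < 1 + jump by rewrite ltr_pwDl.
have nn : (0 <= jump%:E * rearr I f 0)%E by rewrite mule_ge0 ?rearr_ge0 ?lee_fin.
have fin : (jump%:E * rearr I f 0)%E \is a fin_num.
  by rewrite ge0_fin_numE// (le_lt_trans (bound _ ab0f))// ltry.
rewrite -(fineK fin) lee_fin mulrC -ler_pdivrMr//; apply: lb_le_inf.
  by exists (fnorm A0 ab0.1 + fnorm Loo ab0.2), ab0.
move=> _ [ab abf <-]; rewrite ler_pdivrMr// mulrC -lee_fin fineK//.
exact: bound.
Qed.

(** If f y > f^*(0), then f exceeds f^*(0) on all of ]0, y], a set of positive measure. *)
Lemma at0_right0_le_rearr f : lmeas I f -> nonneg_nonincreasing I f ->
  (at0_right f 0 <= rearr I f 0)%E.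
Proof.
move=> mf nf; have [f0 fni] := nf; rewrite (at0_right0 hI)//.
apply: ge_ereal_sup => _ [y + <-]; rewrite /= in_itv/= => /andP[y0 y1].
have Iy : I y by apply: (I_le1 hI); exact: ltW.
rewrite leNgt; apply/negP => fy.
have rf : rearr I f 0 \is a fin_num by rewrite ge0_fin_numE ?rearr_ge0// (lt_trans fy)// ltry.
have r0 : 0 <= fine (rearr I f 0) by rewrite fine_ge0// rearr_ge0.
have : (distr I f (fine (rearr I f 0)) <= 0%:E)%E by apply/(rearr_leP hI) => //; rewrite fineK.
have : (y%:E <= distr I f (fine (rearr I f 0)))%E.
  have := @leb_oc R 0 y (ltW y0); rewrite subr0 => <-.
  apply: leb_subset => x; rewrite /= in_itv/= => /andP[x0 xy].
  have Ix : I x by apply: (I_down hI Iy) => //; exact: ltW.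
  split => //=; rewrite ger0_norm ?f0//; apply: (@lt_le_trans _ _ (f y)); last exact: fni.
  by rewrite -lte_fin fineK.
by move=> h1 h2; have := le_trans h1 h2; rewrite lee_fin leNgt y0.
Qed.

Context (Y Z : @fspace R) (cYZ : couple I A0 A1 Y Z).

Lemma jump_part_le : exists D : R, forall f, Y f -> nonneg_nonincreasing I f ->
  (at0_right f 0 * jump%:E <= (jump * (D * fnorm Y f))%:E)%E.
Proof.
have [_ _ [_ [_ [C HC]]] _] := cYZ.
exists ((1 + jump) / jump * C) => f Yf nf; have Sf := Y_sum cYZ Yf.
have [mf _] := sum_Lambda_finite hI hX Sf.
(* Without an atom the left side is 0 even when f(0+) = +oo, by the convention for products with
   0. *)
have := jump_ge0; rewrite le_eqVlt => /predU1P[<-|j0]; first by rewrite mule0 mul0r.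
have -> : jump * ((1 + jump) / jump * C * fnorm Y f) = (1 + jump) * (C * fnorm Y f).
  by field; rewrite gt_eqF.
apply: (@le_trans _ _ (jump%:E * rearr I f 0)%E).
  by rewrite muleC lee_pmul2l// at0_right0_le_rearr.
apply: le_trans (jump_mul_rearr_le Sf) _.
by rewrite lee_fin ler_pM2l ?HC// ltr_pwDl// ltW.
Qed.

(** Since jump <= phi on ]0, +oo[, this function is bounded by 1. The factor jump in the numerator
    covers the case without an atom, where the function is 0. *)
Lemma jump_over_phi_mem : Z (fun t => jump / phi t).
Proof.
have [_ _ _ [[capZ _] _]] := cYZ; apply: capZ.
have mv : lmeas I (fun t => jump / phi t).
  apply: lmeas_of_borel; first exact: measurable_I.
  apply: (nonincreasing_pos_measurable hI) => x y _ _ x0 xy.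
  have y0 := lt_le_trans x0 xy; rewrite ler_wpM2l ?jump_ge0//.
  by rewrite lef_pV2 ?posrE ?(phi_gt0 hI hX)// fundamental_nondecreasing.
split; last first.
  have [] // := @Linfty_bounded _ I _ 1 mv ler01.
  apply: (aeI_pos hI) => t It t0; have p0 := phi_gt0 hI hX t0.
  rewrite ger0_norm ?divr_ge0 ?jump_ge0 ?(ltW p0)//.
  by rewrite ler_pdivrMr// mul1r jump_le.
split; first exact: mv.
apply: le_lt_trans (Mstar_norm_pointwise hI hX jump_ge0 _) (ltry jump).
move=> t It t0; have p0 := phi_gt0 hI hX t0.
rewrite ger0_norm ?divr_ge0 ?jump_ge0 ?(ltW p0)//.
by rewrite mulrC divfK// gt_eqF.
Qed.

Lemma integral_at0_right f t : nonneg_nonincreasing I f -> I t -> 0 < t ->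
  (\int[dphi X]_(x in `[0%R, t]) at0_right f x =
   at0_right f 0 * jump%:E + \int[dphi X]_(x in `]0%R, t]) (f x)%:E)%E.
Proof.
move=> nf It t0.
have cE : `[0, t]%classic = [set 0] `|` `]0, t]%classic :> set R.
  apply/seteqP; split => x; rewrite /= !in_itv/=.
    by case: (ltP 0 x) => x0 /andP[x0' ->]; [right|left; apply/eqP; rewrite eq_le x0 x0'].
  by move=> [->|/andP[/ltW -> ->]//]; rewrite lexx ltW.
have m0 : measurable ([set 0] : set R) by exact: measurable_set1.
have m1 : measurable (`]0, t]%classic : set R) by exact: measurable_itv.
have mat := measurable_at0_right hI nf It.
rewrite cE in mat *; rewrite (ge0_integral_setU (dphi X) m0 m1 mat).
- rewrite integral_dphi_set1; congr (_ + _)%E; apply: eq_integral => x /set_mem.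
  by rewrite /= in_itv/= => /andP[x0 _]; rewrite at0_right_pos.
- move=> x; rewrite -cE => xt; apply: (at0_right_ge0 hI) => //.
  exact: (subset_itv_I hI (b := true) It).
- by apply/disj_setPS => x [->]; rewrite /= in_itv/= ltxx.
Qed.

Lemma QLambda_bounded_of_average : (forall f, Y f -> Z (avg f)) -> QLambda_bounded X Y Z.
Proof.
move=> TYZ; have [K1 HK1] := weighted_average_bounded hI hX cYZ TYZ.
have [D HD] := jump_part_le.
have [[KY KY1 Yqn] _ Yri] : quasi_banach_ri I Y by case: cYZ.
have [[KZ KZ1 Zqn] _ Zri] : quasi_banach_ri I Z by case: cYZ.
pose v t := jump / phi t; have Zv : Z v := jump_over_phi_mem.
exists (KZ * (`|D| * fnorm Z v + 2 * K1)) => f Yf nf; have [f0 fni] := nf.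
have lf := Y_locally_Lambda hI hX cYZ Yf; have [mf Pf] := lf.
pose G t := (\int[dphi X]_(x in `[0%R, t]) at0_right f x)%E.
have G0 t : I t -> (0 <= G t)%E.
  move=> It; apply: integral_ge0 => x xt; apply: (at0_right_ge0 hI) => //.
  exact: (subset_itv_I hI (b := true) It).
have Gle t : I t -> 0 < t ->
    (G t <= (jump * (D * fnorm Y f) + 2 * (phi t * avg f t))%:E)%E.
  move=> It t0; rewrite /G integral_at0_right// EFinD; apply: leeD; first exact: HD.
  apply: le_trans (integral_dphi_le_weight hI hX It t0 f0 fni) _.
  rewrite EFinM lee_pmul2l// /weighted_average mulVKf ?gt_eqF ?(phi_gt0 hI hX)//.
  rewrite fineK//; apply: integrable_fin_num; first exact: measurable_oc.
  by apply: integrable_mul_weight.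
have Gnd s t : I t -> 0 <= s -> s <= t -> (G s <= G t)%E.
  move=> It s0 st; apply: ge0_subset_integral.
  - exact: measurable_itv.
  - exact: measurable_itv.
  - exact: (measurable_at0_right hI nf It).
  - move=> x xt; apply: (at0_right_ge0 hI) => //.
    exact: (subset_itv_I hI (b := true) It).
  - by move=> x; rewrite /= !in_itv/= => /andP[-> xs]/=; exact: le_trans st.
(* At t = 0, where [Gle] says nothing, G is bounded by its value at 1. *)
have Gfin t : I t -> G t \is a fin_num.
  move=> It; rewrite ge0_fin_numE ?G0//; have [t0|t0] := ltP 0 t.
    by apply: le_lt_trans (Gle t It t0) _; exact: ltry.
  have I1 : I 1 by exact: (I_le1 hI).
  apply: le_lt_trans (Gnd t 1 I1 (I_ge0 hI It) (le_trans t0 ler01)) _.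
  by apply: le_lt_trans (Gle 1 I1 ltr01) _; exact: ltry.
have QE t : I t -> QLambda X f t = ((phi t)^-1 * fine (G t))%:E.
  by move=> It; rewrite EFinM fineK// Gfin.
(* [Gle] divided by phi(t): the first term majorizes the contribution of the atom, the second that
   of ]0, t]. *)
pose h := (D * fnorm Y f) \*o v \+ 2 \*o avg f.
have Zh : Z h by apply: (qn_add Zqn); apply: (qn_scale Zqn) => //; exact: TYZ.
have mQ : lmeas I (fine \o QLambda X f).
  apply: lmeas_of_borel; first exact: measurable_I.
  apply: (eq_measurable_fun (fun t => (phi t)^-1 * fine (G t))).
    by move=> t /set_mem It; rewrite /= QE.
  apply: measurable_funM.
    apply: (nonincreasing_pos_measurable hI) => x y _ _ x0 xy; have y0 := lt_le_trans x0 xy.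
    by rewrite lef_pV2 ?posrE ?(phi_gt0 hI hX)// fundamental_nondecreasing.
  apply: nondecreasing_on_measurable; first exact: is_interval_I.
  move=> x y Ix Iy xy; apply: fine_le; [exact: Gfin|exact: Gfin|].
  by apply: Gnd => //; exact: (I_ge0 hI).
have Qh : aeI I (fun t => `|(fine \o QLambda X f) t| <= `|h t|).
  apply: (aeI_pos hI) => t It t0; have p0 := phi_gt0 hI hX t0.
  rewrite /= QE//= ger0_norm; last first.
    by rewrite mulr_ge0 ?invr_ge0 ?(ltW p0)// fine_ge0// G0.
  apply: le_trans (ler_norm _); rewrite ler_pdivrMl//.
  rewrite -lee_fin fineK ?Gfin//; apply: le_trans (Gle t It t0) _.
  rewrite lee_fin le_eqVlt; apply/orP; left; apply/eqP.
  by rewrite /h /v /=; field; rewrite gt_eqF.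
have [ZQ nQ] := ri_ideal Zri Zh mQ Qh.
split => //; first by move=> t It t0; rewrite QE.
apply: le_trans nQ _.
have Zavg := TYZ f Yf.
apply: le_trans (qn_triangle Zqn (qn_scale Zqn _ Zv) (qn_scale Zqn _ Zavg)) _.
rewrite (qn_norm_scale Zqn _ Zv) (qn_norm_scale Zqn _ Zavg) -mulrA ler_wpM2l//.
  exact: le_trans KZ1.
rewrite mulrDl normrM (ger0_norm (qn_ge0 Yqn Yf)) [`|2|]ger0_norm//.
apply: lerD; first by rewrite mulrAC.
by rewrite -mulrA ler_pM2l// HK1.
Qed.

End QLambdaOfAverage.

Theorem proposition3 (R : realType) (I : set R)
  (hI : I = `[0%R, 1%R]%classic \/ I = `[0%R, +oo[%classic)
  (X : banach_ri I) (hX : standard_fundamental I X) :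
  [/\ class_LI I (Lambda X) (Mstar X) = class_QLI I (Lambda X) (Mstar X),
      class_QLI I (Lambda X) (Mstar X) = class_M I (Lambda X) (Mstar X),
      I = `[0%R, 1%R]%classic ->
        class_LPI I (Lambda X) (Mstar X) = class_M I (Lambda X) (Mstar X)
    & forall Y Z : @fspace R, couple I (Lambda X) (Mstar X) Y Z ->
        [/\ class_LI I (Lambda X) (Mstar X) (Y, Z) <-> QLambda_bounded X Y Z,
            class_QLI I (Lambda X) (Mstar X) (Y, Z) <-> QLambda_bounded X Y Z,
            class_M I (Lambda X) (Mstar X) (Y, Z) <-> QLambda_bounded X Y Z
          & I = `[0%R, 1%R]%classic ->
            (class_LPI I (Lambda X) (Mstar X) (Y, Z) <->
             QLambda_bounded X Y Z)]].
Proof.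
have H (Y Z : @fspace R) : couple I (Lambda X) (Mstar X) Y Z ->
        [/\ class_LI I (Lambda X) (Mstar X) (Y, Z) <-> QLambda_bounded X Y Z,
            class_QLI I (Lambda X) (Mstar X) (Y, Z) <-> QLambda_bounded X Y Z,
            class_M I (Lambda X) (Mstar X) (Y, Z) <-> QLambda_bounded X Y Z
          & I = `[0%R, 1%R]%classic ->
            (class_LPI I (Lambda X) (Mstar X) (Y, Z) <->
             QLambda_bounded X Y Z)].
  move=> cYZ.
  (* The implications form a cycle from Q through M, [majorized], QLI and LI back to Q. On [0, 1],
     LPI is attached by an implication from [majorized] and one to Q. *)
  have QM := QLambda_class_M hI hX cYZ.
  have MD := class_M_majorized hI hX cYZ.
  have DQ := majorized_QLI hI hX cYZ.
  have QL := QLI_LI hI cYZ.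
  have LQ : class_LI I (Lambda X) (Mstar X) (Y, Z) -> QLambda_bounded X Y Z.
    move=> /(class_LI_weighted_average hI hX); exact: QLambda_bounded_of_average.
  split.
  - by split => // /QM/MD/DQ/QL.
  - by split => [/QL/LQ//|/QM/MD/DQ].
  - by split => // /MD/DQ/QL/LQ.
  - move=> I1; split => [/(class_LPI_weighted_average hI hX I1)|/QM/MD].
      exact: QLambda_bounded_of_average.
    exact: majorized_LPI.
split => [|||//].
- apply/seteqP; split => -[Y Z] cl; have [cYZ _] := cl;
    have [LQ QQ _ _] := H Y Z cYZ; first exact/QQ/LQ.
  exact/LQ/QQ.
- apply/seteqP; split => -[Y Z] cl; have [cYZ _] := cl;
    have [_ QQ MQ _] := H Y Z cYZ; first exact/MQ/QQ.
  exact/QQ/MQ.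
- move=> I1; apply/seteqP; split => -[Y Z] cl; have [cYZ _] := cl;
    have [_ _ MQ /(_ I1) PQ] := H Y Z cYZ; first exact/MQ/PQ.
  exact/PQ/MQ.
Qed.
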